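(* Let $H\in\mathbb{R}^{d\times d}$ be symmetric positive semidefinite, let $\rho>0$, set $H_\rho = H+\rho I$, and let $\delta\in(0,1)$. Let $\Omega\in\mathbb{R}^{d\times s}$ have i.i.d. standard Gaussian entries, and let $P$ be the randomized Nyström preconditioner built from $\Omega$ (defined in the context). If the sketch size satisfies \[ s\geq 8\left(\sqrt{d_{\mathrm{eff}}(\rho)}+\sqrt{8\log(16/\delta)}\right)^{2}, \] then with probability at least $1-\delta$, \[ \kappa_{2}\big(P^{-1/2}H_{\rho}P^{-1/2}\big)\leq 8 . \]
   Context: For symmetric psd $H$ and $\rho>0$, the effective dimension is $d_{\mathrm{eff}}(\rho)=\mathrm{tr}\big(H(H+\rho I)^{-1}\big)$. Given a test matrix $\Omega\in\mathbb{R}^{d\times s}$, the Nyström approximation of $H$ is $H\langle\Omega\rangle=(H\Omega)(\Omega^{T}H\Omega)^{\dagger}(H\Omega)^{T}$, where $\dagger$ is the Moore–Penrose pseudoinverse. Write it in eigendecomposed form $H\langle\Omega\rangle=U\hat\Lambda U^{T}$, with $U\in\mathbb{R}^{d\times s}$ having orthonormal columns and $\hat\Lambda=\mathrm{diag}(\hat\lambda_1\ge\dots\ge\hat\lambda_s)\succeq 0$. The randomized Nyström preconditioner is \[ P=\frac{1}{\hat\lambda_s+\rho}\,U(\hat\Lambda+\rho I)U^{T}+(I-UU^{T}). \] $\kappa_2$ denotes the spectral condition number (ratio of largest to smallest eigenvalue for a symmetric positive definite matrix). *)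

(* Defs.v *)
From HB Require Import structures.
From mathcomp Require Import all_boot all_order all_algebra.
From mathcomp Require Import all_classical all_reals all_analysis.
Set Implicit Arguments. Unset Strict Implicit. Unset Printing Implicit Defensive.
Import Order.TTheory GRing.Theory Num.Theory.
Local Open Scope classical_set_scope.
Local Open Scope ring_scope.

Section Defs.
Variable R : realType.

Definition psd n (M : 'M[R]_n) : Prop :=
  M^T = M /\ forall v : 'cV[R]_n, 0 <= (v^T *m M *m v) 0 0.
Definition spd n (M : 'M[R]_n) : Prop :=
  M^T = M /\ forall v : 'cV[R]_n, v != 0 -> 0 < (v^T *m M *m v) 0 0.

Definition eff_dim n (H : 'M[R]_n) (rho : R) : R :=
  \tr (H *m invmx (H + rho%:M)).

(* Moore--Penrose pseudoinverse, characterized by the four Penrose equations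
   (it exists and is unique). *)
Definition is_mp_pinv m n (A : 'M[R]_(m, n)) (X : 'M[R]_(n, m)) : Prop :=
  [/\ A *m X *m A = A, X *m A *m X = X,
      (A *m X)^T = A *m X & (X *m A)^T = X *m A].
Definition mp_pinv m n (A : 'M[R]_(m, n)) : 'M[R]_(n, m) :=
  xget 0 [set X | is_mp_pinv A X].

Definition nystrom d s (H : 'M[R]_d) (Om : 'M[R]_(d, s)) : 'M[R]_d :=
  (H *m Om) *m mp_pinv (Om^T *m H *m Om) *m (H *m Om)^T.

Definition nystrom_eig d s (A : 'M[R]_d) (U : 'M[R]_(d, s)) (lam : 'rV[R]_s)
  : Prop :=
  [/\ U^T *m U = 1%:M,
      (forall i j : 'I_s, (i <= j)%N -> lam 0 j <= lam 0 i),
      (forall i : 'I_s, 0 <= lam 0 i) &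
      A = U *m diag_mx lam *m U^T].

Definition last_entry s : 'rV[R]_s -> R :=
  match s return 'rV[R]_s -> R with
  | 0 => fun _ => 0
  | n.+1 => fun v => v 0 ord_max
  end.

Definition nystrom_precond d s (U : 'M[R]_(d, s)) (lam : 'rV[R]_s) (rho : R)
  : 'M[R]_d :=
  (last_entry lam + rho)^-1 *: (U *m (diag_mx lam + rho%:M) *m U^T)
  + (1%:M - U *m U^T).

(* the psd square root of a psd matrix (exists and is unique) *)
Definition psd_sqrt n (M : 'M[R]_n) : 'M[R]_n :=
  xget 0 [set S | psd S /\ S *m S = M].

Definition inv_sqrt n (P : 'M[R]_n) : 'M[R]_n := psd_sqrt (invmx P).

Definition kappa2 n (M : 'M[R]_n) : R :=
  sup [set a : R | eigenvalue M a] / inf [set a : R | eigenvalue M a].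

End Defs.

Definition mutually_independent (R : realType) (d0 : measure_display)
  (T : measurableType d0) (Pr : probability T R) (I : finType)
  (X : I -> T -> R) : Prop :=
  forall (J : {set I}) (B : I -> set R), (forall i, measurable (B i)) ->
    Pr (\bigcap_(i in [set i | i \in J]) (X i @^-1` B i)) =
    (\prod_(i in J) Pr (X i @^-1` B i))%E.

Definition iid_std_gaussian (R : realType) (d0 : measure_display)
  (T : measurableType d0) (Pr : probability T R) (d s : nat)
  (Om : T -> 'M[R]_(d, s)) : Prop :=
  [/\ (forall i j, measurable_fun setT (fun t => Om t i j)),
      (forall i j (B : set R), measurable B ->
          Pr ((fun t => Om t i j) @^-1` B) = normal_prob 0 1 B) &
      mutually_independent Pr (fun ij : 'I_d * 'I_s => fun t => Om t ij.1 ij.2)].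

(* Main.v *)
Require Import Defs.
From HB Require Import structures.
From mathcomp Require Import all_boot all_order all_algebra.
From mathcomp Require Import ring lra.
From mathcomp Require Import all_classical all_reals all_analysis.
From mathcomp Require Import measurable_realfun.
Set Implicit Arguments. Unset Strict Implicit. Unset Printing Implicit Defensive.
Import Order.TTheory GRing.Theory Num.Theory.
Local Open Scope classical_set_scope.
Local Open Scope ring_scope.

(** Write [E] for the difference of [H] and its Nystrom approximation, [l] for
    the last eigenvalue of that approximation and [D = H (H + rho)^-1], so that
    [k = tr D] is the effective dimension.
    Since [rho P <= H + rho <= (l + rho + |E|) P], it suffices that
    [l <= rho / 7] and [|E| <= 48 rho / 7].  The former follows from [8 k <= s].
    The latter holds as soon as [|H w|^2 <= 48/7 rho <w, H w>] whenever
    [Om^T H w = 0].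

    The kernel estimate is obtained by a barrier argument which processes the
    columns [w] of [Om] one at a time.  Starting from [C = D], each column first
    replaces [C^-1] by [C^-1 + g w w^T] with [g] infinite, which decreases the
    trace of [C], and then by [C^-1 - e I], where [e] is the largest shift (up to
    a constant) for which the trace does not exceed its value before the step.
    As [C] stays positive semidefinite, the sum [c] of all the shifts satisfies
    [c |D x|^2 <= <x, D x>] whenever [Om^T D x = 0], and [c >= 55/48] is enough.
    Given the past, [e] is bounded below by a multiple of the ratio of the two
    quadratic forms [<w, C^2 w>] and [<w, C w>], and second and fourth Gaussian
    moments suffice to show that [E exp (- 5/12 k e) <= 11/12].  Markov's inequality
    then bounds the failure probability by [exp (275/576 k) (11/12)^s <= delta]. *)

(** * Quadratic forms *)

Section QuadraticForms.
Variables (R : realType) (n : nat).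
Implicit Types (M C : 'M[R]_n) (u v w x y z : 'cV[R]_n) (a b : R).

Definition bform M u v : R := (u^T *m M *m v) 0 0.

Lemma bformDl M u v w : bform M (u + v) w = bform M u w + bform M v w.
Proof. by rewrite /bform linearD /= !mulmxDl mxE. Qed.
Lemma bformDr M u v w : bform M w (u + v) = bform M w u + bform M w v.
Proof. by rewrite /bform mulmxDr mxE. Qed.
Lemma bformZl M a u v : bform M (a *: u) v = a * bform M u v.
Proof. by rewrite /bform linearZ /= -!scalemxAl mxE. Qed.
Lemma bformZr M a u v : bform M u (a *: v) = a * bform M u v.
Proof. by rewrite /bform -scalemxAr mxE. Qed.
Lemma bformNl M u v : bform M (- u) v = - bform M u v.
Proof. by rewrite -scaleN1r bformZl mulN1r. Qed.
Lemma bformNr M u v : bform M u (- v) = - bform M u v.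
Proof. by rewrite -scaleN1r bformZr mulN1r. Qed.
Lemma bform0l M v : bform M 0 v = 0.
Proof. by rewrite /bform linear0 !mul0mx mxE. Qed.
Lemma bform0r M v : bform M v 0 = 0.
Proof. by rewrite /bform mulmx0 mxE. Qed.

Lemma bformD M C u v : bform (M + C) u v = bform M u v + bform C u v.
Proof. by rewrite /bform mulmxDr mulmxDl mxE. Qed.
Lemma bformZ M a u v : bform (a *: M) u v = a * bform M u v.
Proof. by rewrite /bform -scalemxAr -scalemxAl mxE. Qed.
Lemma bformN M u v : bform (- M) u v = - bform M u v.
Proof. by rewrite -scaleN1r bformZ mulN1r. Qed.
Lemma bform_scalar a u v : bform a%:M u v = a * bform 1%:M u v.
Proof. by rewrite -(scalemx1 _ a) bformZ. Qed.

Lemma bformM M C u v : bform (M *m C) u v = bform 1%:M (M^T *m u) (C *m v).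
Proof. by rewrite /bform mulmx1 trmx_mul trmxK !mulmxA. Qed.
Lemma bform1E M u v : bform M u v = bform 1%:M u (M *m v).
Proof. by rewrite /bform mulmx1 mulmxA. Qed.

Lemma bform_sym M u v : M^T = M -> bform M u v = bform M v u.
Proof.
move=> sM; rewrite /bform.
have -> : v^T *m M *m u = (u^T *m M *m v)^T by rewrite !trmx_mul trmxK sM mulmxA.
by rewrite [RHS]mxE.
Qed.
Lemma bform1C u v : bform 1%:M u v = bform 1%:M v u.
Proof. by apply: bform_sym; rewrite trmx1. Qed.

Lemma bform1_sum u v : bform 1%:M u v = \sum_i u i 0 * v i 0.
Proof. by rewrite /bform mulmx1 mxE; apply: eq_bigr => i _; rewrite mxE. Qed.

Lemma bform_delta M i j : bform M (delta_mx i 0) (delta_mx j 0) = M i j.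
Proof. by rewrite /bform -colE trmx_delta -rowE !mxE. Qed.

Lemma bform1_ge0 u : 0 <= bform 1%:M u u.
Proof. by rewrite bform1_sum sumr_ge0 // => i _; rewrite -expr2 sqr_ge0. Qed.

Lemma bform1_eq0 u : bform 1%:M u u = 0 -> u = 0.
Proof.
rewrite bform1_sum => /eqP; rewrite psumr_eq0; last by move=> i _; rewrite -expr2 sqr_ge0.
move=> /allP u0; apply/matrixP => i j; rewrite ord1 mxE.
by have := u0 i (mem_index_enum _); rewrite /= mulf_eq0 orbb => /eqP.
Qed.

Lemma bform1_gt0 u : u != 0 -> 0 < bform 1%:M u u.
Proof.
move=> u0; rewrite lt_def bform1_ge0 andbT; apply: contraNneq u0 => /bform1_eq0 ->.
by [].
Qed.

Lemma psd1 : psd (1%:M : 'M[R]_n).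
Proof. by split; [rewrite trmx1 | exact: bform1_ge0]. Qed.

(** If [c > 0], the parabola is evaluated at its vertex [- b / c]. If [c = 0], a nonzero [b] would
    let the affine function take the value -1. *)
Lemma discr_le0 (a b c : R) :
  0 <= c -> (forall x : R, 0 <= a + 2 * x * b + x ^+ 2 * c) -> b ^+ 2 <= a * c.
Proof.
move=> c0 H; have [ce0|cn0] := eqVneq c 0.
  have : b = 0.
    apply/eqP; rewrite -[_ == _]negbK; apply/negP => bn0.
    have := H (- (a + 1) / (2 * b)); rewrite ce0 mulr0 addr0.
    have -> : 2 * (- (a + 1) / (2 * b)) * b = - (a + 1) by field.
    by lra.
  by move=> ->; rewrite ce0; lra.
have cp : 0 < c by rewrite lt_def cn0.
have := H (- b / c).
have -> : a + 2 * (- b / c) * b + (- b / c) ^+ 2 * c = (a * c - b ^+ 2) / c by field.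
by rewrite pmulr_lge0 ?invr_gt0 // subr_ge0.
Qed.

Lemma psd_cauchy M u v :
  psd M -> bform M u v ^+ 2 <= bform M u u * bform M v v.
Proof.
move=> [sM pM]; apply: discr_le0; first exact: pM.
move=> x; have := pM (u + x *: v).
rewrite -/(bform _ _ _) !bformDl !bformDr !bformZl !bformZr (bform_sym v u sM).
by set p := bform M u u; set q := bform M v v; set r := bform M u v => ?; lra.
Qed.

(** Cauchy-Schwarz against [M *m v] gives [|M v|^4 <= 0]. *)
Lemma psd_bform_eq0 M v : psd M -> bform M v v = 0 -> M *m v = 0.
Proof.
move=> pM v0; apply: bform1_eq0.
have := psd_cauchy (M *m v) v pM; rewrite v0 mulr0 (bform1E M (M *m v) v).
by rewrite -[leRHS]/(0) => h; apply/eqP; rewrite -sqrf_eq0 eq_le h sqr_ge0.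
Qed.

Lemma psd_diag_ge0 M i : psd M -> 0 <= M i i.
Proof.
by move=> [_ pM]; have := pM (delta_mx i 0); rewrite -/(bform _ _ _) bform_delta.
Qed.

Lemma psd_tr_ge0 M : psd M -> 0 <= \tr M.
Proof. by move=> pM; rewrite sumr_ge0 // => i _; exact: psd_diag_ge0. Qed.

Lemma psd_entry_sqr M i j : psd M -> M i j ^+ 2 <= M i i * M j j.
Proof.
by move=> pM; have := psd_cauchy (delta_mx i 0) (delta_mx j 0) pM; rewrite !bform_delta.
Qed.

Lemma tr_mulmx_tr M C : \tr (M^T *m C) = \sum_i \sum_j M i j * C i j.
Proof.
rewrite exchange_big; apply: eq_bigr => j _; rewrite mxE.
by apply: eq_bigr => i _; rewrite mxE.
Qed.

Lemma sym_tr_sqr M : M^T = M -> \tr (M *m M) = \sum_i \sum_j M i j ^+ 2.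
Proof.
move=> sM; rewrite -{1}sM tr_mulmx_tr.
by apply: eq_bigr => i _; apply: eq_bigr => j _; rewrite expr2.
Qed.

Lemma sym_tr_sqr_ge0 M : M^T = M -> 0 <= \tr (M *m M).
Proof.
move=> sM; rewrite sym_tr_sqr // !sumr_ge0 // => i _.
by rewrite sumr_ge0 // => j _; exact: sqr_ge0.
Qed.

Lemma sym_tr_sqr_eq0 M : M^T = M -> \tr (M *m M) = 0 -> M = 0.
Proof.
move=> sM; rewrite sym_tr_sqr // pair_bigA /= => /eqP.
rewrite psumr_eq0; last by move=> i _; rewrite sqr_ge0.
move=> /allP M0; apply/matrixP => i j; rewrite mxE.
by have := M0 (i, j) (mem_index_enum _); rewrite /= sqrf_eq0 => /eqP.
Qed.

Lemma psd_tr_sqr_le M : psd M -> \tr (M *m M) <= (\tr M) ^+ 2.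
Proof.
move=> pM; rewrite sym_tr_sqr ?(proj1 pM) // expr2 mulr_suml.
apply: ler_sum => i _; rewrite mulr_sumr; apply: ler_sum => j _.
exact: psd_entry_sqr.
Qed.

Lemma psd_tr_eq0 M : psd M -> \tr M = 0 -> M = 0.
Proof.
move=> pM t0; apply: (sym_tr_sqr_eq0 (proj1 pM)); apply/eqP.
rewrite eq_le sym_tr_sqr_ge0 ?(proj1 pM) // andbT.
by rewrite (le_trans (psd_tr_sqr_le pM)) // t0 expr0n.
Qed.

(** Serves to bound, and hence to integrate, the random coefficients of the quadratic forms
    below. *)
Lemma psd_entry_le M i j : psd M -> `|M i j| <= \tr M.
Proof.
move=> pM; have M0 := psd_tr_ge0 pM.
rewrite -(ler_pXn2r (n := 2)) ?nnegrE // real_normK ?num_real //.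
apply: le_trans (psd_tr_sqr_le pM); rewrite sym_tr_sqr ?(proj1 pM) //.
rewrite (bigD1 i) //= (bigD1 j) //= -addrA lerDl addr_ge0 ?sumr_ge0 // => k _.
  exact: sqr_ge0.
by rewrite sumr_ge0 // => l _; exact: sqr_ge0.
Qed.

Lemma sqr_psd M : M^T = M -> psd (M *m M).
Proof.
move=> sM; split; first by rewrite trmx_mul sM.
by move=> v; rewrite -/(bform _ _ _) bformM sM bform1_ge0.
Qed.

Lemma tr_bform_delta M : \tr M = \sum_i bform M (delta_mx i 0) (delta_mx i 0).
Proof. by apply: eq_bigr => i _; rewrite bform_delta. Qed.

Lemma mulmx_norm_le M v : M^T = M ->
  bform 1%:M (M *m v) (M *m v) <= \tr (M *m M) * bform 1%:M v v.
Proof.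
move=> sM; rewrite bform1_sum sym_tr_sqr // mulr_suml; apply: ler_sum => i _.
have -> : (M *m v) i 0 = bform 1%:M (row i M)^T v.
  by rewrite bform1_sum mxE; apply: eq_bigr => j _; rewrite !mxE.
have -> : \sum_j M i j ^+ 2 = bform 1%:M (row i M)^T (row i M)^T.
  by rewrite bform1_sum; apply: eq_bigr => j _; rewrite !mxE expr2.
by rewrite -expr2; apply: psd_cauchy psd1.
Qed.

(** The Frobenius norm dominates the operator norm, so an [l] that bounds it can stand in for the
    largest eigenvalue. *)
Lemma psd_rayleigh_le M v l : psd M -> 0 <= l -> \tr (M *m M) <= l ^+ 2 ->
  bform M v v <= l * bform 1%:M v v.
Proof.
move=> pM l0 hl; have [sM p0] := pM; have v0 := bform1_ge0 v.
rewrite -(ler_pXn2r (n := 2)) ?nnegrE ?mulr_ge0 //; last exact: p0.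
have := psd_cauchy v (M *m v) psd1; rewrite -bform1E => /le_trans; apply.
have h : \tr (M *m M) * bform 1%:M v v <= l ^+ 2 * bform 1%:M v v by apply: ler_wpM2r.
have := le_trans (mulmx_norm_le v sM) h.
by move: (bform 1%:M v v) (bform _ (M *m v) _) v0 => p q p0' h2; nra.
Qed.

(** This is [M^2 <= l M]. Cauchy-Schwarz gives [|M v|^4 <= <v, M v> <M v, M M v>], the Rayleigh
    bound turns the last factor into [l |M v|^2], and one factor [|M v|^2] cancels. *)
Lemma psd_mulmx_norm_le M v l : psd M -> 0 <= l -> \tr (M *m M) <= l ^+ 2 ->
  bform 1%:M (M *m v) (M *m v) <= l * bform M v v.
Proof.
move=> pM l0 hl; have [sM p0] := pM.
have := psd_cauchy (M *m v) v pM; rewrite (bform1E M (M *m v) v).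
have := psd_rayleigh_le (M *m v) pM l0 hl; have := p0 v; have := bform1_ge0 (M *m v).
rewrite -/(bform _ _ _); move: (bform 1%:M _ _) (bform M v v) (bform M _ _) => p q r.
move=> p_ge0 q0 h1 h2; have [->|pn0] := eqVneq p 0; first by rewrite mulr_ge0.
have pp : 0 < p by rewrite lt_def pn0.
by rewrite -(ler_pM2l pp) -expr2 (le_trans h2) //; nra.
Qed.

Lemma pos_unitmx M m : 0 < m ->
  (forall v, m * bform 1%:M v v <= bform M v v) -> M \in unitmx.
Proof.
move=> m0 h; rewrite -unitmx_tr -row_free_unit; apply/row_freeP.
have : kermx M^T = 0.
  apply/eqP/rowV0P => v /sub_kermxP v0.
  have Mv : M *m v^T = 0 by rewrite -(trmxK M) -trmx_mul v0 trmx0.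
  have := h v^T; rewrite (bform1E M) Mv bform0r pmulr_rle0 // => h'.
  have /bform1_eq0 : bform 1%:M v^T v^T = 0 by apply/eqP; rewrite eq_le h' bform1_ge0.
  by move=> /(congr1 trmx); rewrite trmxK trmx0.
by move=> /eqP; rewrite kermx_eq0 => /row_freeP.
Qed.

Lemma bform_inv M v : M^T = M -> M \in unitmx ->
  bform (invmx M) v v = bform M (invmx M *m v) (invmx M *m v).
Proof.
by move=> sM uM; rewrite (bform1E M) mulKVmx // bform1C -bform1E.
Qed.

(* Completing the square at [invmx C *m v]. *)
Lemma bform_inv_le M C v : M^T = M -> M \in unitmx -> C^T = C -> C \in unitmx ->
  (forall x, 0 <= bform C x x) ->
  (forall x, bform C x x <= bform M x x) ->
  bform (invmx M) v v <= bform (invmx C) v v.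
Proof.
move=> sM uM sC uC pC CM.
pose x := invmx M *m v; pose y := invmx C *m v.
have e1 : bform (invmx M) v v = bform M x x by rewrite bform_inv.
have e2 : bform (invmx C) v v = bform C y y by rewrite bform_inv.
have e3 : bform C x y = bform M x x.
  by rewrite (bform1E C) (bform1E M) !mulKVmx.
have := pC (x - y); have := CM x.
rewrite !(bformDl, bformDr, bformNl, bformNr) (bform_sym y x sC) e1 e2 e3.
by lra.
Qed.

Lemma invmx_sym M : M^T = M -> (invmx M)^T = invmx M.
Proof. by move=> sM; rewrite trmx_inv sM. Qed.

End QuadraticForms.

(** * One step of the barrier argument *)

Section Barrier.
Variables (R : realType) (n : nat).
Implicit Types (C : 'M[R]_n) (w u z : 'cV[R]_n).

(* The limit of [(C^-1 + g w w^T)^-1] as [g] tends to infinity; it is [C] itself if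
   [bform C w w = 0], since [0^-1 = 0]. *)
Definition deflate C w : 'M[R]_n :=
  C - (bform C w w)^-1 *: (C *m w *m (C *m w)^T).

(* With [q = tr (C^2)] and [dl] the trace lost in [deflate], this is [4/5 dl / q].
   The factor 4/5 lets the trace regain at most [dl], because [r - r^2 <= 1/4] for
   [r = dl / sqrt q]. *)
Definition bshift C w : R :=
  4 / 5 * (bform (C *m C) w w / (bform C w w * \tr (C *m C))).

(* [(C'^-1 - e I)^-1] with [C' = deflate C w] and [e = bshift C w]. *)
Definition barrier_step C w : 'M[R]_n :=
  let C' := deflate C w in C' *m invmx (1%:M - bshift C w *: C').

Lemma bform_rank1 u w z : bform (u *m u^T) w z = bform 1%:M w u * bform 1%:M u z.
Proof. by rewrite /bform !mulmx1 mulmxA -mulmxA mxE big_ord1. Qed.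

Lemma deflate_bform C w u : C^T = C ->
  bform (deflate C w) u u = bform C u u - bform C u w ^+ 2 / bform C w w.
Proof.
move=> sC; rewrite /deflate bformD bformN bformZ bform_rank1.
by rewrite (bform1C (C *m w)) -!bform1E; ring.
Qed.

Lemma deflate_psd C w : psd C -> psd (deflate C w).
Proof.
move=> pC; have [sC p0] := pC; split.
  by rewrite /deflate linearB linearZ /= !trmx_mul !trmxK sC !mulmxA.
move=> v; rewrite -/(bform _ _ _) deflate_bform // subr_ge0.
have [->|b0] := eqVneq (bform C w w) 0; first by rewrite invr0 mulr0 p0.
by rewrite ler_pdivrMr ?psd_cauchy // lt_def b0 p0.
Qed.

Lemma deflate_tr C w : C^T = C ->
  \tr (deflate C w) = \tr C - bform (C *m C) w w / bform C w w.
Proof.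
move=> sC; rewrite /deflate linearB linearZ /= mxtrace_mulC.
have -> : \tr ((C *m w)^T *m (C *m w)) = bform (C *m C) w w.
  by rewrite /bform /mxtrace big_ord1 trmx_mul sC !mulmxA.
by rewrite mulrC.
Qed.

(** With [v = C w], [a = |v|^2] and [b = <w, C w>], the left side is
    [tr (C^2) - 2 <v, C v> / b + a^2 / b^2], and Cauchy-Schwarz gives
    [<v, C v> / b >= (a / b)^2]. *)
Lemma deflate_tr_sqr C w : psd C ->
  \tr (deflate C w *m deflate C w) <=
  \tr (C *m C) - (bform (C *m C) w w / bform C w w) ^+ 2.
Proof.
move=> pC; have [sC p0] := pC.
set b := bform C w w; set a := bform (C *m C) w w; pose v := C *m w.
have ea : a = bform 1%:M v v by rewrite /a bformM sC.
have tr1 (A : 'M[R]_n) : \tr (A *m (v *m v^T)) = bform A v v.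
  by rewrite /bform mulmxA mxtrace_mulC /mxtrace big_ord1 mulmxA.
have -> : \tr (deflate C w *m deflate C w) =
   \tr (C *m C) - 2 * b^-1 * bform C v v + b^-1 ^+ 2 * a ^+ 2.
  rewrite /deflate -/v -/b mulmxBl !mulmxBr !raddfB /=.
  rewrite -!scalemxAl -!scalemxAr !mxtraceZ.
  rewrite [\tr (_ *m _ *m C)]mxtrace_mulC !tr1 bform_rank1 -ea.
  by ring.
have [b0|b0] := eqVneq b 0; first by rewrite b0 invr0; lra.
have bp : 0 < b by rewrite lt_def b0 p0.
have h : a ^+ 2 <= bform C v v * b.
  by have := psd_cauchy v w pC; rewrite (bform1E C v w) -ea.
have : a ^+ 2 / b ^+ 2 <= bform C v v / b.
  by rewrite ler_pdivrMr ?exprn_gt0 // (le_trans h) // expr2 mulrA divfK.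
have -> : (a / b) ^+ 2 = a ^+ 2 / b ^+ 2 by rewrite expr_div_n.
have -> : b^-1 ^+ 2 * a ^+ 2 = a ^+ 2 / b ^+ 2 by field.
by lra.
Qed.

Lemma bshift_ge0 C w : psd C -> 0 <= bshift C w.
Proof.
move=> [sC p0]; rewrite /bshift mulr_ge0 ?divr_ge0 ?mulr_ge0 ?p0 //.
- by rewrite -/(bform _ _ _) bformM sC bform1_ge0.
- exact: sym_tr_sqr_ge0.
Qed.

(** Here [l] bounds the norm of the deflated matrix [C'] and [m] bounds [1 - e C'] from below, where
    [e] is the shift. The last inequality says that the trace regained by the shift, at most
    [e tr (C'^2) / m], does not exceed the trace lost by deflation. The witness for [l] is the
    Frobenius norm of [C]. *)
Lemma deflate_resolvent C w : psd C ->
  exists l m : R, [/\ 0 <= l, \tr (deflate C w *m deflate C w) <= l ^+ 2,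
    0 < m, m = 1 - bshift C w * l &
    bshift C w * \tr (deflate C w *m deflate C w)
      <= bform (C *m C) w w / bform C w w * m].
Proof.
move=> pC; have [sC p0] := pC; set C' := deflate C w.
set q := \tr (C *m C); set dl := bform (C *m C) w w / bform C w w.
have q0 : 0 <= q := sym_tr_sqr_ge0 sC.
have q'0 : 0 <= \tr (C' *m C') := sym_tr_sqr_ge0 (proj1 (deflate_psd w pC)).
have q'q : \tr (C' *m C') <= q - dl ^+ 2 := deflate_tr_sqr w pC.
have dl0 : 0 <= dl.
  by apply: divr_ge0; [rewrite bformM sC bform1_ge0 | exact: p0].
have es : bshift C w = 4 / 5 * (dl / q) by rewrite /bshift /dl invfM !mulrA.
exists (Num.sqrt q), (1 - bshift C w * Num.sqrt q).
set l := Num.sqrt q; have l0 : 0 <= l := sqrtr_ge0 q.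
have lq : l ^+ 2 = q by rewrite sqr_sqrtr.
have [qe0|qn0] := eqVneq q 0.
  have s0 : bshift C w = 0 by rewrite es qe0 invr0 !mulr0.
  rewrite lq s0 !mul0r subr0 ltr01 mulr1; split => //.
  by rewrite (le_trans q'q) // lerBlDr lerDl sqr_ge0.
have qp : 0 < q by rewrite lt_def qn0.
have lp : 0 < l by rewrite sqrtr_gt0.
have ln0 : l != 0 by rewrite gt_eqF.
pose r := dl / l; have edl : dl = r * l by rewrite divfK.
have r0 : 0 <= r by rewrite divr_ge0.
(* Since [tr (C'^2)] is nonnegative, [dl^2 <= q]. *)
have r1 : r <= 1.
  rewrite ler_pdivrMr // mul1r -(ler_pXn2r (n := 2)) ?nnegrE // lq; lra.
have esl : bshift C w * l = 4 / 5 * r by rewrite es -lq edl; field.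
split => //.
- by rewrite lq (le_trans q'q) // lerBlDr lerDl sqr_ge0.
- by rewrite esl; lra.
rewrite esl (le_trans (ler_wpM2l (bshift_ge0 w pC) q'q)) // es -lq edl.
have -> : 4 / 5 * (r * l / l ^+ 2) * (l ^+ 2 - (r * l) ^+ 2) =
  (r * l) * (4 / 5 * (1 - r ^+ 2)) by field.
apply: ler_wpM2l; first exact: mulr_ge0.
(* Once [r l] is cancelled, the gap between the two sides is [4/5 (r - 1/2)^2]. *)
by have := sqr_ge0 (r - 1 / 2); lra.
Qed.

(** The rank-one correction sees [u] only through [<w, C u> = <w, z> = 0]. *)
Lemma deflate_ker C w u z : C^T = C ->
  C *m u = z -> bform 1%:M w z = 0 -> deflate C w *m u = z.
Proof.
move=> sC Cu wz; rewrite /deflate mulmxBl Cu -scalemxAl trmx_mul sC.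
rewrite -[_ *m (w^T *m C) *m u]mulmxA.
have -> : w^T *m C *m u = 0.
  apply/matrixP => i j; rewrite !ord1 [RHS]mxE.
  by rewrite -/(bform C w u) bform1E Cu.
by rewrite mulmx0 scaler0 subr0.
Qed.

(** The last clause says that [C^-1 z = u] becomes [C^-1 z = u - e z]. It is phrased without
    inverses because deflation makes the matrices singular. *)
Lemma barrier_step_props C w : psd C ->
  [/\ 1%:M - bshift C w *: deflate C w \in unitmx,
      psd (barrier_step C w), \tr (barrier_step C w) <= \tr C &
      forall u z, C *m u = z -> bform 1%:M w z = 0 ->
        barrier_step C w *m (u - bshift C w *: z) = z].
Proof.
move=> pC; have [sC p0] := pC; rewrite /barrier_step.
have [l [m [l0 hl m0 em hm]]] := deflate_resolvent w pC.
have := deflate_tr w sC; have := (fun u z => @deflate_ker C w u z sC).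
have := deflate_psd w pC; have := bshift_ge0 w pC; move: em hm hl.
move: (deflate C w) (bshift C w) => C' e /= em hm hl e0 pC' kC' trC'.
have [sC' p0'] := pC'.
set N := 1%:M - e *: C'.
have sN : N^T = N by rewrite /N linearB linearZ /= trmx1 sC'.
have Nm v : m * bform 1%:M v v <= bform N v v.
  rewrite /N bformD bformN bformZ em.
  have := psd_rayleigh_le v pC' l0 hl; move: (bform _ v v) (bform _ v v) => p q h.
  have : e * q <= e * (l * p) by rewrite ler_wpM2l.
  by lra.
have uN : N \in unitmx by exact: pos_unitmx m0 Nm.
have cN : C' *m N = N *m C'.
  by rewrite /N mulmxBr mulmxBl mulmx1 mul1mx -scalemxAl -scalemxAr.
have cK : C' *m invmx N = invmx N *m C'.
  by rewrite -[RHS](mulmxK uN) -(mulmxA (invmx N)) cN mulKmx.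
have sK : (invmx N)^T = invmx N by exact: invmx_sym.
(* From [m <= N] follows [N^-1 <= 1 / m]: with [y = N^-1 v] and [p = <v, y>], one has
   [p^2 <= |v|^2 |y|^2] and [m |y|^2 <= p]. *)
have Kle v : bform (invmx N) v v <= m^-1 * bform 1%:M v v.
  have e1 : bform (invmx N) v v = bform N (invmx N *m v) (invmx N *m v).
    by rewrite bform_inv.
  have := Nm (invmx N *m v); rewrite -e1.
  have := psd_cauchy v (invmx N *m v) (psd1 R n); rewrite -bform1E.
  have := bform1_ge0 v; have := bform1_ge0 (invmx N *m v).
  move: (bform _ v v) (bform 1%:M v v) (bform 1%:M _ _) => p q r r0 q0 h1 h2.
  have p_ge0 : 0 <= p by apply: le_trans h2; rewrite mulr_ge0 // ltW.
  rewrite ler_pdivlMl //.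
  have [->|pn0] := eqVneq p 0; first by rewrite mulr0.
  have pp : 0 < p by rewrite lt_def pn0.
  rewrite -(ler_pM2l pp).
  have -> : p * (m * p) = m * p ^+ 2 by ring.
  apply: le_trans (ler_wpM2l (ltW m0) h1) _.
  have -> : m * (q * r) = (m * r) * q by ring.
  by rewrite ler_wpM2r.
split => //.
- split; first by rewrite trmx_mul sK sC' -cK.
  move=> v; rewrite -/(bform _ _ _).
  set y := invmx N *m v.
  (* Substituting [v = N y] removes the inverse; [C'^2 <= l C'] then leaves at least
     [m <y, C' y>]. *)
  have -> : bform (C' *m invmx N) v v = bform C' y y - e * bform 1%:M (C' *m y) (C' *m y).
    rewrite bformM sC' -/y.
    have {1}-> : v = N *m y by rewrite mulKVmx.
    rewrite mulmxA cN -mulmxA /N mulmxBl mul1mx -scalemxAl.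
    rewrite bformDl bformNl bformZl !(bform1C _ y) -!bform1E.
    by rewrite (bform_sym _ (C' *m y) sC') (bform1E C' (C' *m y)).
  have := psd_mulmx_norm_le y pC' l0 hl; have := p0' y; rewrite -/(bform _ _ _).
  move: (bform C' y y) (bform 1%:M _ _) => p q p_ge0 h.
  have h1 : e * q <= e * (l * p) by rewrite ler_wpM2l.
  have h2 : 0 <= m * p by rewrite mulr_ge0 // ltW.
  by rewrite em in h2; lra.
(* The resolvent identity isolates the trace regained by the shift. *)
- have -> : C' *m invmx N = C' + e *: (C' *m invmx N *m C').
    rewrite -[in RHS]mulmxA -cK mulmxA scalemxAl.
    rewrite -{2}[C'](mulmxK uN) -mulmxDl; congr (_ *m _).
    by rewrite /N mulmxBr mulmx1 -scalemxAr subrK.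
  rewrite linearD linearZ /= trC' -addrA gerDl.
  have : \tr (C' *m invmx N *m C') <= m^-1 * \tr (C' *m C').
    rewrite !tr_bform_delta mulr_sumr; apply: ler_sum => i _.
    rewrite -mulmxA !bformM sC' -mulmxA -bform1E.
    exact: Kle.
  move=> h; rewrite addrC subr_le0 (le_trans (ler_wpM2l e0 h)) //.
  rewrite mulrCA mulrC ler_pdivrMr //.
- move=> u z Cu wz.
  have C'u : C' *m u = z by exact: kC'.
  rewrite cK -mulmxA mulmxBr C'u -scalemxAr.
  have -> : z - e *: (C' *m z) = N *m z by rewrite /N mulmxBl mul1mx -scalemxAl.
  by rewrite mulKmx.
Qed.

End Barrier.

(** * From the kernel estimate to the condition number *)

Section PseudoInverse.
Variable R : realType.

Lemma trmx_mul_row0 m n (A : 'M[R]_(m, n)) : A *m A^T = 0 -> A = 0.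
Proof.
move=> A0; apply/row_matrixP => i; rewrite row0; apply: trmx_inj; rewrite trmx0.
apply: bform1_eq0; rewrite bform1_sum.
have := congr1 (fun B : 'M[R]_m => B i i) A0; rewrite !mxE => h; rewrite -[RHS]h.
by apply: eq_bigr => j _; rewrite !mxE.
Qed.

Lemma gram_row_free m n (G : 'M[R]_(m, n)) : row_free G -> G *m G^T \in unitmx.
Proof.
move=> fG; rewrite -row_free_unit -kermx_eq0; apply/rowV0P => v /sub_kermxP v0.
have vG : v *m G = 0.
  by apply: trmx_mul_row0; rewrite trmx_mul mulmxA -(mulmxA v) v0 mul0mx.
by apply/eqP; rewrite -(mulmx_free_eq0 _ fG) vG.
Qed.

(** Existence comes from a full-rank factorisation [A = F G], for which
    [G^T (G G^T)^-1 (F^T F)^-1 F^T] satisfies the four equations. The default value in [mp_pinv] is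
    therefore never taken for lack of a pseudoinverse. *)
Lemma mp_pinvP m n (A : 'M[R]_(m, n)) : is_mp_pinv A (mp_pinv A).
Proof.
suff [X HX] : exists X, is_mp_pinv A X.
  by rewrite /mp_pinv; case: xgetP => [Y -> //|/(_ X)]; case.
have [r [F [G [FG fF fG]]]] : exists r (F : 'M[R]_(m, r)) (G : 'M[R]_(r, n)),
    [/\ F *m G = A, row_free F^T & row_free G].
  exists (\rank A), (col_base A), (row_base A).
  by rewrite mulmx_base row_base_free -row_leq_rank mxrank_tr col_leq_rank col_base_full.
have uG := gram_row_free fG.
have uF : F^T *m F \in unitmx by rewrite -{2}[F]trmxK gram_row_free.
set X := G^T *m invmx (G *m G^T) *m invmx (F^T *m F) *m F^T.
have AX : A *m X = F *m invmx (F^T *m F) *m F^T.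
  rewrite -FG /X !mulmxA -(mulmxA F G) -(mulmxA F (G *m G^T)) mulmxV //.
  by rewrite mulmx1.
have XA : X *m A = G^T *m invmx (G *m G^T) *m G.
  rewrite -FG /X !mulmxA -(mulmxA _ F^T F) -(mulmxA _ _ (F^T *m F)) mulVmx //.
  by rewrite mulmx1.
exists X; split.
- by rewrite AX -FG !mulmxA -(mulmxA _ F^T F) -(mulmxA F) mulVmx // mulmx1.
- rewrite XA /X !mulmxA -(mulmxA _ G G^T) -(mulmxA G^T _ (G *m G^T)) mulVmx //.
  by rewrite mulmx1.
- by rewrite AX !trmx_mul trmxK trmx_inv trmx_mul trmxK mulmxA.
- by rewrite XA !trmx_mul trmxK trmx_inv trmx_mul trmxK mulmxA.
Qed.

End PseudoInverse.

(** * Spectral bounds for the preconditioned matrix *)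

Section Preconditioner.
Variables (R : realType) (d : nat).
Implicit Types (H P S : 'M[R]_d) (v w : 'cV[R]_d).

Lemma kappa2_le (M : 'M[R]_d) (m : R) : 0 < m ->
  (forall a, eigenvalue M a -> m <= a <= 8 * m) -> kappa2 M <= 8.
Proof.
move=> m0 h; rewrite /kappa2; set A := [set a | _].
(* Without eigenvalues [sup] takes its default value 0, and so does the quotient. *)
have [->|/set0P A0] := eqVneq A set0; first by rewrite sup0 mul0r.
have sA : sup A <= 8 * m by apply: ge_sup => // a /h /andP[].
have iA : m <= inf A by apply: lb_le_inf => // a /h /andP[].
rewrite ler_pdivrMr ?(lt_le_trans m0) //; apply: le_trans sA _.
by rewrite ler_wpM2l.
Qed.

(** Eigenvalues of [S M S] are the quotients [<w, M w> / <w, P w>] at [w = S v], because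
    [S P S = 1]. The alternative [S = 0] is the default value of [psd_sqrt], for which [kappa2]
    evaluates to 0. *)
Lemma kappa2_precond_le P S M (m : R) : 0 < m -> P \in unitmx ->
  S = 0 \/ psd S /\ S *m S = invmx P ->
  (forall v, m * bform P v v <= bform M v v <= 8 * m * bform P v v) ->
  kappa2 (S *m M *m S) <= 8.
Proof.
move=> m0 uP [->|[[sS _] SS]] h.
  rewrite !mul0mx /kappa2.
  suff A0 (a : R) : eigenvalue (0 : 'M[R]_d) a -> a = 0.
    have [A0'|/set0P[b hb]] := eqVneq [set a | eigenvalue (0 : 'M[R]_d) a] set0.
      by rewrite A0' sup0 mul0r.
    have -> : [set a | eigenvalue (0 : 'M[R]_d) a] = [set 0].
      by apply/seteqP; split => [a /A0|a ->] //=; rewrite -(A0 b hb).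
    by rewrite sup1 mul0r.
  move=> /eigenvalueP[v]; rewrite mulmx0 => /esym/eqP.
  by rewrite scaler_eq0 => /orP[/eqP->|/eqP->]; rewrite ?eqxx.
have uS : S \in unitmx.
  have : S *m S \in unitmx by rewrite SS unitmx_inv.
  by rewrite unitmx_mul => /andP[].
have SPS : S *m P *m S = 1%:M.
  apply: (can_inj (mulKmx uS)); rewrite mulmx1 !mulmxA SS mulVmx //.
  by rewrite mul1mx.
apply: kappa2_le m0 _ => a /eigenvalueP[v va v0].
pose w := S *m v^T.
have wM : bform M w w = a * bform 1%:M v^T v^T.
  rewrite /bform /w trmx_mul sS !trmxK mulmxA -(mulmxA v S M) -(mulmxA v) va.
  by rewrite -scalemxAl mxE mulmx1.
have wP : bform P w w = bform 1%:M v^T v^T.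
  by rewrite /bform /w trmx_mul sS !trmxK mulmxA -(mulmxA v S P) -(mulmxA v) SPS.
have vp : 0 < bform 1%:M v^T v^T by apply: bform1_gt0; rewrite trmx_eq0.
by have := h w; rewrite wM wP !ler_pM2r.
Qed.

Lemma bform_conj_diag s (U : 'M[R]_(d, s)) (D : 'rV[R]_s) v :
  bform (U *m diag_mx D *m U^T) v v = \sum_i D 0 i * (U^T *m v) i 0 ^+ 2.
Proof.
rewrite /bform !mulmxA -(mulmxA _ U^T v) -[v^T *m U]trmxK trmx_mul trmxK.
rewrite mul_mx_diag mxE; apply: eq_bigr => i _; rewrite !mxE.
by ring.
Qed.

Lemma bform_proj s (U : 'M[R]_(d, s)) v :
  bform (U *m U^T) v v = \sum_i (U^T *m v) i 0 ^+ 2.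
Proof.
have -> : U *m U^T = U *m diag_mx (const_mx 1) *m U^T.
  by rewrite diag_const_mx mulmx1.
by rewrite bform_conj_diag; apply: eq_bigr => i _; rewrite mxE mul1r.
Qed.

Lemma eig_last_le s (A : 'M[R]_d) (U : 'M[R]_(d, s.+1)) (lam : 'rV[R]_s.+1) v :
  nystrom_eig A U lam -> last_entry lam * bform (U *m U^T) v v <= bform A v v.
Proof.
move=> [_ mono _ ->]; rewrite bform_conj_diag bform_proj mulr_sumr.
by apply: ler_sum => i _; rewrite ler_wpM2r ?sqr_ge0 // mono // leq_ord.
Qed.

(** With [Q = U U^T] and [l] the last eigenvalue, [(l + rho) P = A + rho Q + (l + rho) (1 - Q)].
    Both bounds are compared with this form, term by term. *)
Lemma precond_sandwich s (H : 'M[R]_d) (U : 'M[R]_(d, s.+1)) (lam : 'rV[R]_s.+1)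
    (A : 'M[R]_d) (rho e : R) :
  0 < rho -> nystrom_eig A U lam ->
  (forall v, bform A v v <= bform H v v <= bform A v v + e * bform 1%:M v v) ->
  0 <= e -> last_entry lam + e <= 7 * rho ->
  nystrom_precond U lam rho \in unitmx /\
  forall v, rho * bform (nystrom_precond U lam rho) v v <= bform (H + rho%:M) v v
    <= 8 * rho * bform (nystrom_precond U lam rho) v v.
Proof.
move=> rho0 eigA AH e0 le7; have [UU lam_mono lam0 EA] := eigA.
set P := nystrom_precond U lam rho; set l := last_entry lam in le7 *.
have l0 : 0 <= l by exact: lam0.
have lr : 0 < l + rho by rewrite ltr_wpDl.
pose p v i := (U^T *m v) i 0 ^+ 2.
have p0 v i : 0 <= p v i by exact: sqr_ge0.
have UUform v : bform (U *m U^T) v v = \sum_i p v i := bform_proj U v.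
have Aform v : bform A v v = \sum_i lam 0 i * p v i by rewrite EA bform_conj_diag.
have proj v : \sum_i p v i <= bform 1%:M v v.
  have sQ : (1%:M - U *m U^T)^T = 1%:M - U *m U^T.
    by rewrite linearB /= trmx1 trmx_mul trmxK.
  have QQ : (1%:M - U *m U^T) *m (1%:M - U *m U^T) = 1%:M - U *m U^T.
    rewrite mulmxBr mulmx1 mulmxBl mul1mx mulmxA -(mulmxA U) UU mulmx1 subrr.
    by rewrite subr0.
  have := proj2 (sqr_psd sQ) v.
  by rewrite QQ -/(bform _ v v) bformD bformN UUform subr_ge0.
have Pform v : (l + rho) * bform P v v =
   \sum_i lam 0 i * p v i + rho * \sum_i p v i
   + (l + rho) * (bform 1%:M v v - \sum_i p v i).
  rewrite /P /nystrom_precond -/l !(bformD, bformN, bformZ).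
  rewrite mulmxDr mulmxDl -EA bformD Aform mul_mx_scalar -scalemxAl bformZ UUform.
  by field; rewrite gt_eqF.
have lsum v : l * \sum_i p v i <= \sum_i lam 0 i * p v i.
  by rewrite -UUform -Aform; exact: eig_last_le eigA.
have P1 v : bform 1%:M v v <= bform P v v.
  by rewrite -(ler_pM2l lr) Pform; have := lsum v; lra.
split; first by apply: (pos_unitmx ltr01) => v; rewrite mul1r.
move=> v; have /andP[AH1 AH2] := AH v.
rewrite bformD bform_scalar; apply/andP; split.
  rewrite -(ler_pM2l lr) mulrCA Pform.
  move: (lsum v) (proj v) AH1 (bform1_ge0 v); rewrite Aform.
  have : 0 <= \sum_i p v i by rewrite sumr_ge0.
  move: (\sum_i p v i) (\sum_i lam 0 i * p v i) (bform H v v) (bform 1%:M v v).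
  move=> a b h n a0 lab an bh n0.
  have b0 : 0 <= b by exact: le_trans (mulr_ge0 l0 a0) lab.
  (* The gap in the lower bound, times [l + rho], is [(l + rho) (h - b) + l (b + rho a)]. *)
  have : 0 <= l * (b + rho * a).
    by apply: mulr_ge0 => //; apply: addr_ge0 => //; apply: mulr_ge0 => //; exact: ltW.
  have : 0 <= (l + rho) * (h - b) by rewrite mulr_ge0 ?subr_ge0 // ltW.
  by lra.
move: (Pform v) (lsum v) (proj v) AH2 (P1 v) (bform1_ge0 v); rewrite Aform.
have : 0 <= \sum_i p v i by rewrite sumr_ge0.
move: (\sum_i p v i) (\sum_i lam 0 i * p v i) (bform H v v) (bform 1%:M v v) (bform P v v).
move=> a b h n P' a0 EP lab an bh nP n0.
(* These show [h + rho n <= (l + rho + e) P'], and [l + rho + e <= 8 rho]. *)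
have h1 : 0 <= l * (n - a) by rewrite mulr_ge0 // subr_ge0.
have h2 : 0 <= e * (P' - n) by rewrite mulr_ge0 // subr_ge0.
have h3 : (l + e) * P' <= 7 * rho * P'.
  by rewrite ler_wpM2r // (le_trans n0).
by lra.
Qed.

(** The residual [r = v - Om X Om^T H v] satisfies [Om^T H r = 0], and [H] exceeds its approximation
    at [v] by [<r, H r> = <v, H r>]. Cauchy-Schwarz and the hypothesis give [<r, H r>^2 <= |v|^2 |H
    r|^2 <= e |v|^2 <r, H r>]. *)
Lemma nystrom_residual s H (Om : 'M[R]_(d, s)) (e : R) : psd H -> 0 <= e ->
  (forall w, Om^T *m (H *m w) = 0 ->
     bform 1%:M (H *m w) (H *m w) <= e * bform H w w) ->
  forall v, bform (nystrom H Om) v v <= bform H v v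
    <= bform (nystrom H Om) v v + e * bform 1%:M v v.
Proof.
move=> pH e0 hker v; have [sH p0] := pH.
set M := Om^T *m H *m Om; set X := mp_pinv M.
have [MXM _ _ _] := mp_pinvP M; rewrite -/X in MXM.
(* The equation [M X M = M] only yields [Y H Y^T = 0] for [Y = (1 - M X) Om^T]; positivity of [H]
   upgrades it to [Y H = 0]. *)
have MX : M *m X *m (Om^T *m H) = Om^T *m H.
  pose Y := (1%:M - M *m X) *m Om^T.
  have YH : Y *m H *m Y^T = 0.
    rewrite /Y trmx_mul trmxK !mulmxA -(mulmxA _ Om^T) -(mulmxA _ (Om^T *m H)) -/M.
    by rewrite mulmxBl mul1mx MXM subrr mul0mx.
  have : Y *m H = 0.
    apply/row_matrixP => i; rewrite row_mul row0; apply: trmx_inj.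
    rewrite trmx0 trmx_mul sH; apply: psd_bform_eq0 pH _.
    by rewrite /bform trmxK tr_row -!row_mul colE mulmxA YH mul0mx !mxE.
  by rewrite /Y -mulmxA mulmxBl mul1mx => /eqP; rewrite subr_eq0 => /eqP <-.
pose r := v - Om *m (X *m (Om^T *m (H *m v))).
have kr : Om^T *m (H *m r) = 0.
  rewrite /r !mulmxBr; apply/eqP; rewrite subr_eq0; apply/eqP.
  by rewrite [LHS]mulmxA -[in LHS]MX /M !mulmxA.
have EN : bform (nystrom H Om) v v = bform H v v - bform H v r.
  rewrite /r bformDr bformNr opprD opprK addNKr /nystrom -/M -/X.
  by rewrite /bform trmx_mul sH !mulmxA.
have rr : bform H v r = bform H r r.
  set y := X *m (Om^T *m (H *m v)).
  have Oy : bform H (Om *m y) r = 0.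
    by rewrite bform1E /bform trmx_mul mulmx1 -mulmxA kr mulmx0 mxE.
  have -> : bform H r r = bform H v r - bform H (Om *m y) r.
    by rewrite -bformNl -bformDl.
  by rewrite Oy oppr0 !addr0.
have hr := hker _ kr; have r0 := p0 r; rewrite -/(bform _ _ _) in r0.
have cs := psd_cauchy v (H *m r) (psd1 R d).
rewrite -bform1E rr in cs; rewrite EN rr.
apply/andP; split; first by lra.
suff : bform H r r <= e * bform 1%:M v v by lra.
have n0 := bform1_ge0 v.
move: (bform H r r) (bform 1%:M v v) (bform 1%:M _ _) hr r0 cs n0 => p n q hq hp hpn hn.
have [->|pn0] := eqVneq p 0; first by rewrite mulr_ge0.
have pp : 0 < p by rewrite lt_def pn0.
rewrite -(ler_pM2l pp) -expr2 (le_trans hpn) //.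
by have := ler_wpM2l hn hq; lra.
Qed.

(** The effective dimension is monotone in the matrix, and that of [l U U^T] is [s l / (l + rho)].
    Monotonicity is read off the form [tr (1 - rho (H + rho)^-1)], using that inversion reverses the
    order. *)
Lemma precond_last_le s H (U : 'M[R]_(d, s)) (l rho : R) : psd H -> 0 < rho ->
  0 <= l -> U^T *m U = 1%:M ->
  (forall v, l * bform (U *m U^T) v v <= bform H v v) ->
  s%:R * l <= (l + rho) * eff_dim H rho.
Proof.
move=> [sH p0] rho0 l0 UU hl.
have lr : 0 < l + rho by rewrite ltr_wpDl.
pose Q := U *m U^T; pose C := l *: Q + rho%:M.
have sQ : Q^T = Q by rewrite /Q trmx_mul trmxK.
have QQ : Q *m Q = Q by rewrite /Q mulmxA -(mulmxA U) UU mulmx1.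
have sC : C^T = C by rewrite /C linearD linearZ /= sQ tr_scalar_mx.
have Q0 v : 0 <= bform Q v v by rewrite -QQ bformM sQ bform1_ge0.
have Cr v : rho * bform 1%:M v v <= bform C v v.
  by rewrite /C bformD bformZ bform_scalar lerDr mulr_ge0.
have uC : C \in unitmx by exact: pos_unitmx rho0 Cr.
pose M := H + rho%:M.
have sM : M^T = M by rewrite /M linearD /= sH tr_scalar_mx.
have CM v : bform C v v <= bform M v v.
  by rewrite /C /M !bformD lerD2r bformZ; exact: hl.
have uM : M \in unitmx by apply: (pos_unitmx rho0) => v; exact: le_trans (CM v).
have HM : H *m invmx M = 1%:M - rho *: invmx M.
  have {1}-> : H = M - rho%:M by rewrite /M addrK.
  by rewrite mulmxBl mulmxV // mul_scalar_mx.
(* [C] acts as [l + rho] on the range of the projection [Q] and as [rho] on its complement. *)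
have iC : rho *: invmx C = 1%:M - (l / (l + rho)) *: Q.
  have CQ : C *m Q = (l + rho) *: Q.
    by rewrite /C mulmxDl -scalemxAl QQ mul_scalar_mx -scalerDl.
  apply: (can_inj (mulKmx uC)); rewrite -scalemxAr mulmxV // mulmxBr mulmx1.
  rewrite -scalemxAr CQ scalerA divfK ?gt_eqF // /C scalemx1.
  by rewrite addrAC subrr add0r.
have trQ : \tr Q = s%:R by rewrite /Q mxtrace_mulC UU mxtrace1.
have : \tr (rho *: invmx M) <= \tr (rho *: invmx C).
  rewrite !mxtraceZ ler_pM2l // !tr_bform_delta; apply: ler_sum => i _.
  apply: bform_inv_le => // v; apply: le_trans (Cr v).
  by rewrite mulr_ge0 ?bform1_ge0 // ltW.
rewrite iC raddfB /= !mxtraceZ trQ => h.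
rewrite /eff_dim -/M HM raddfB /= mxtraceZ.
have -> : s%:R * l = (l + rho) * (l / (l + rho) * s%:R) by field; rewrite gt_eqF.
by rewrite ler_pM2l //; lra.
Qed.

End Preconditioner.

(** * Gaussian moments *)

Section RealIntegrals.
Context (d0 : measure_display) (T : measurableType d0) (R : realType).
Variable mu : {measure set T -> \bar R}.
Implicit Types f g : T -> R.
Local Notation rint f := (mu.-integrable setT (EFin \o (f))).

Lemma rintD f g : rint f -> rint g -> rint (fun x => f x + g x).
Proof. exact: integrableD. Qed.

Lemma rintZ (a : R) f : rint f -> rint (fun x => a * f x).
Proof. exact: integrableZl. Qed.

Lemma rint_sum (I : finType) (f : I -> T -> R) :
  (forall i, rint (f i)) -> rint (fun x => \sum_i f i x).
Proof.
move=> h; suff -> : EFin \o (fun x => \sum_i f i x) =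
    (fun x => \sum_(i <- index_enum I) (EFin \o f i) x)%E.
  by apply: integrable_sum => //.
by apply/funext => x /=; rewrite -sumEFin.
Qed.

Lemma Rintegral_sum (I : finType) (f : I -> T -> R) : (forall i, rint (f i)) ->
  \int[mu]_x (\sum_i f i x) = \sum_i \int[mu]_x f i x.
Proof.
move=> h; rewrite -[RHS]/(fine (\sum_i \int[mu]_x f i x)%:E) -sumEFin.
rewrite /Rintegral; congr fine.
under eq_integral do rewrite -sumEFin.
rewrite (@integral_sum _ _ _ _ _ measurableT _ (fun i x => (f i x)%:E) h).
apply: eq_bigr => i _; rewrite fineK //.
exact: (integrable_fin_num measurableT (h i)).
Qed.

Lemma rint_le f g : measurable_fun setT f -> rint g ->
  (forall x, `|f x| <= `|g x|) -> rint f.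
Proof.
move=> mf ig fg; apply: le_integrable ig => //; first exact/measurable_EFinP.
by move=> x _; rewrite lee_fin.
Qed.

End RealIntegrals.

Section RealIntegralsFinite.
Context (d0 : measure_display) (T : measurableType d0) (R : realType).
Variable P : probability T R.
Implicit Types f g : T -> R.
Local Notation rint f := (P.-integrable setT (EFin \o (f))).

Lemma rint_cst (a : R) : rint (fun=> a).
Proof. exact: finite_measure_integrable_cst. Qed.

Lemma Rintegral_cst1 (a : R) : \int[P]_x a = a.
Proof. by rewrite /Rintegral integral_cst //= probability_setT mule1. Qed.

Lemma rint_bounded f (K : R) : measurable_fun setT f -> (forall x, `|f x| <= K) -> rint f.
Proof.
move=> mf fK; apply: rint_le mf (rint_cst K) _ => x.
by rewrite (le_trans (fK x)) // ler_norm.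
Qed.

End RealIntegralsFinite.

Section NormalMoments.
Variable R : realType.
Local Notation mu := (@lebesgue_measure R).
Local Notation N := (@normal_prob R 0 1).

Lemma expR_ge_quadratic (y : R) : 0 <= y -> 1 + y + y ^+ 2 / 2 <= expR y.
Proof.
move=> y0; have nd : nondecreasing_seq (series (exp_coeff y)).
  by apply/nondecreasing_seqP => k; rewrite seriesSr lerDl exp_coeff_ge0.
have := nondecreasing_cvgn_le nd (is_cvg_series_exp_coeff y) 3%N.
rewrite /series /= !big_nat_recr //= big_nil add0r /exp_coeff /=.
by rewrite expr0 expr1 !fact0 !factS fact0 !muln1 !divr1.
Qed.

(** The Radon-Nikodym derivative of the Gaussian law agrees almost everywhere with the density,
    since both integrate to the measure of every set. *)
Lemma ge0_integral_normal (f : measurableTypeR R -> \bar R) : (forall x, 0 <= f x)%E ->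
  measurable_fun setT f ->
  (\int[N]_x f x = \int[mu]_x (f x * (normal_pdf 0 1 x)%:E))%E.
Proof.
move=> f0 mf; have dom := @normal_prob_dominates R 0 1.
rewrite -(Radon_Nikodym_SigmaFinite.change_of_variables dom) //.
have ig := Radon_Nikodym_SigmaFinite.f_integrable dom.
apply: ae_eq_integral => //.
- by apply: emeasurable_funM => //; exact: measurable_int ig.
- by apply: emeasurable_funM => //; apply/measurable_EFinP; exact: measurable_normal_pdf.
- apply: ae_eqe_mul2l; apply: integral_ae_eq => //.
  + by apply/measurable_EFinP; exact: measurable_normal_pdf.
  + by move=> E _ mE; rewrite -Radon_Nikodym_SigmaFinite.f_integral.
Qed.

(** The weight turns the standard density into [s] times the density of standard deviation [s]. The
    second and fourth moments are extracted from this identity for [s] near 1. *)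
Lemma integral_normal_exp_sqr (s : R) : 0 < s ->
  (\int[N]_x (expR ((1 - s ^- 2) / 2 * x ^+ 2))%:E = s%:E)%E.
Proof.
move=> s0; rewrite ge0_integral_normal; first last.
- apply/measurable_EFinP; apply: measurableT_comp => //.
  by apply: measurable_funM => //; exact: measurable_funX.
- by move=> x; rewrite lee_fin expR_ge0.
transitivity (\int[mu]_x (s%:E * (normal_pdf 0 s x)%:E))%E; last first.
  by rewrite integralZl ?integral_normal_pdf ?mule1 //; exact: integrable_normal_pdf.
apply: eq_integral => x _; rewrite -!EFinM; congr (_%:E).
have sn0 : s != 0 by rewrite gt_eqF.
rewrite !normal_pdfE ?oner_eq0 //; rewrite /normal_peak /normal_fun !subr0.
rewrite mulrCA -expRD [RHS]mulrA; congr (_ * expR _); last by field.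
rewrite expr1n mul1r -mulrnAr sqrtrM ?sqr_ge0 // sqrtr_sqr ger0_norm ?ltW //.
by rewrite invfM mulrA divff // mul1r.
Qed.

Lemma normal_sym (A : set R) : measurable A -> N (-%R @^-1` A) = N A.
Proof.
move=> mA; rewrite /normal_prob.
have mf : measurable_fun setT (fun x : R => (normal_pdf 0 1 x)%:E).
  by apply/measurable_EFinP; exact: measurable_normal_pdf.
transitivity (\int[pushforward mu (-%R : _ -> measurableTypeR R)]_(x in A)
   (normal_pdf 0 1 x)%:E)%E.
  rewrite ge0_integral_pushforward //=; last 2 first.
  - exact: measurable_funS mf.
  - by move=> x _; rewrite lee_fin normal_pdf_ge0.
  apply: eq_integral => x _; congr (_%:E).
  by rewrite !normal_pdfE ?oner_eq0 // /normal_fun !subr0 sqrrN.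
by apply: eq_measure_integral => B mB _; exact: lebesgue_measureN.
Qed.

Lemma integrable_normal_exp_sqr (s : R) : 0 < s ->
  N.-integrable setT (fun x => (expR ((1 - s ^- 2) / 2 * x ^+ 2))%:E).
Proof.
move=> s0; apply/integrableP; split.
  apply/measurable_EFinP; apply: measurableT_comp => //.
  by apply: measurable_funM => //; exact: measurable_funX.
under eq_integral do rewrite gee0_abs ?lee_fin ?expR_ge0 //.
by rewrite integral_normal_exp_sqr // ltry.
Qed.

Lemma integrable_normal_pow k : (k <= 4)%N ->
  N.-integrable setT (fun x => (x ^+ k)%:E).
Proof.
move=> k4; pose h : R := (1 - 2 ^- 2) / 2.
have h0 : 0 < h by rewrite /h; lra.
have i1 := integrable_normal_exp_sqr (ltr0n R 2).
have i2 : N.-integrable setT (fun x : R => (1 + 2 / h ^+ 2 * expR (h * x ^+ 2))%:E).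
  by apply: rintD; [exact: rint_cst | exact: rintZ].
apply: le_integrable i2 => //.
  by apply/measurable_EFinP; exact: measurable_funX.
move=> x _ /=; rewrite lee_fin (ger0_norm (addr_ge0 _ _)) //; last first.
  by rewrite mulr_ge0 ?expR_ge0 // divr_ge0 // ltW // exprn_gt0.
(* This is the quadratic term of the exponential at [h x^2]; with [s = 2] the constant is
   [h = 3/8]. *)
have x4 : x ^+ 4 <= 2 / h ^+ 2 * expR (h * x ^+ 2).
  rewrite mulrAC ler_pdivlMr ?exprn_gt0 //.
  have := @expR_ge_quadratic (h * x ^+ 2) (mulr_ge0 (ltW h0) (sqr_ge0 x)).
  have hx : 0 <= h * x ^+ 2 by rewrite mulr_ge0 ?sqr_ge0 // ltW.
  have -> : x ^+ 4 * h ^+ 2 = (h * x ^+ 2) ^+ 2 by ring.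
  lra.
have x40 : 0 <= x ^+ 4 by rewrite exprn_even_ge0.
rewrite normrX; have [x1|x1] := leP `|x| 1.
  by have := exprn_ile1 k (normr_ge0 x) x1; lra.
have := ler_weXn2l (ltW x1) k4; rewrite -(normrX 4) (ger0_norm x40).
by lra.
Qed.

Definition nmom k : R := \int[N]_x x ^+ k.

Lemma nmom0 : nmom 0 = 1.
Proof.
rewrite /nmom /Rintegral; under eq_integral do rewrite expr0.
by rewrite integral_cst //= probability_setT mule1.
Qed.

(** The law is invariant under negation, which flips the sign of an odd power. *)
Lemma nmom_odd k : (k <= 4)%N -> odd k -> nmom k = 0.
Proof.
move=> k4 ok; suff : nmom k = - nmom k by lra.
have ik := integrable_normal_pow k4.
rewrite -mulN1r /nmom -RintegralZl // /Rintegral.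
transitivity (fine (\int[pushforward N (-%R : _ -> measurableTypeR R)]_x (x ^+ k)%:E)).
  by congr fine; apply: eq_measure_integral => A mA _; exact/esym/normal_sym.
have mk : measurable_fun setT (fun x : R => (x ^+ k)%:E).
  by apply/measurable_EFinP; exact: measurable_funX.
have e x : (- x) ^+ k = -1 * x ^+ k :> R by rewrite exprNn -signr_odd ok expr1.
rewrite integral_pushforward //=; last first.
  rewrite preimage_setT; apply: eq_integrable (rintZ (-1) ik) => //= x _.
  by rewrite e.
by rewrite preimage_setT; congr fine; apply: eq_integral => x _; rewrite /= e.
Qed.

Lemma Rintegral_normal_exp_sqr (s : R) : 0 < s ->
  \int[N]_x expR ((1 - s ^- 2) / 2 * x ^+ 2) = s.
Proof. by move=> s0; rewrite /Rintegral integral_normal_exp_sqr. Qed.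

Lemma Rintegral_normal_affine (h : R) :
  \int[N]_x (1 + h * x ^+ 2) = 1 + h * nmom 2.
Proof.
have i2 := @integrable_normal_pow 2 isT.
rewrite (RintegralD measurableT (rint_cst N 1) (rintZ h i2)) Rintegral_cst1.
by rewrite (RintegralZl _ measurableT i2).
Qed.

(** Integrates [1 + y <= exp y] at [y = (1 - s^-2) / 2 x^2]. For [s > 1] it bounds the moment from
    above, for [s < 1] from below. *)
Lemma nmom2_bound (s : R) : 0 < s -> 1 + (1 - s ^- 2) / 2 * nmom 2 <= s.
Proof.
move=> s0; set h := _ / 2.
have i2 : N.-integrable setT (EFin \o (fun x : R => h * x ^+ 2)).
  by apply: rintZ; exact: integrable_normal_pow.
rewrite -[leRHS](Rintegral_normal_exp_sqr s0) -/h.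
rewrite -Rintegral_normal_affine; apply: le_Rintegral => //.
- by apply: rintD => //; exact: rint_cst.
- exact: integrable_normal_exp_sqr.
- by move=> x _; exact: expR_ge1Dx.
Qed.

(** Taking [s = 1 + u] gives [(2 + u) m <= 2 (1 + u)^2], and [s = 1 - u] gives
    [(2 - u) m >= 2 (1 - u)^2]; then [u] is made small. *)
Lemma nmom2 : nmom 2 = 1.
Proof.
have b (s : R) : 0 < s -> (s ^+ 2 - 1) * nmom 2 <= 2 * s ^+ 2 * (s - 1).
  move=> s0; have := nmom2_bound s0.
  have s2 : 0 < s ^+ 2 by rewrite exprn_gt0.
  rewrite -(ler_pM2r s2).
  have -> : (1 + (1 - s ^- 2) / 2 * nmom 2) * s ^+ 2 =
     s ^+ 2 + (s ^+ 2 - 1) * nmom 2 / 2 by field; rewrite gt_eqF.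
  by lra.
have m0 : 0 <= nmom 2 by apply: Rintegral_ge0 => x _; exact: sqr_ge0.
apply/eqP; rewrite eq_le; apply/andP; split; apply/ler_addgt0Pr => e e0.
  pose u := Num.min (e / 8) 1.
  have u0 : 0 < u by rewrite lt_min divr_gt0 ?ltr01.
  have [ue u1] : u <= e / 8 /\ u <= 1 by rewrite /u !ge_min !lexx ?orbT.
  have := b (1 + u) (addr_gt0 ltr01 u0).
  have -> : ((1 + u) ^+ 2 - 1) * nmom 2 = u * ((2 + u) * nmom 2) by ring.
  have -> : 2 * (1 + u) ^+ 2 * (1 + u - 1) = u * (2 * (1 + u) ^+ 2) by ring.
  rewrite ler_pM2l // => h.
  have h1 : 0 <= u * nmom 2 by rewrite mulr_ge0 // ltW.
  have h2 : u ^+ 2 <= u by rewrite expr2 ler_piMr // ltW.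
  by lra.
pose u := Num.min (e / 8) (1 / 2).
have u0 : 0 < u by rewrite lt_min !divr_gt0.
have [ue u1] : u <= e / 8 /\ u <= 1 / 2 by rewrite /u !ge_min !lexx ?orbT.
have v0 : 0 < 1 - u by lra.
have := b (1 - u) v0.
have -> : ((1 - u) ^+ 2 - 1) * nmom 2 = - (u * ((2 - u) * nmom 2)) by ring.
have -> : 2 * (1 - u) ^+ 2 * (1 - u - 1) = - (u * (2 * (1 - u) ^+ 2)) by ring.
rewrite lerN2 ler_pM2l // => h.
have h1 : 0 <= u * nmom 2 by rewrite mulr_ge0 // ltW.
have h2 : 0 <= u ^+ 2 by rewrite sqr_ge0.
by lra.
Qed.

(** Integrates [1 + y + y^2 / 2 <= exp y] at [y = h x^2] with [s = 1 + u], which gives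
    [h^2 m <= 2 (u - h)]. As [u] tends to 0, [h] behaves like [u] and the right side like
    [3 u^2]. *)
Lemma nmom4_le3 : nmom 4 <= 3.
Proof.
apply/ler_addgt0Pr => e e0.
pose u := e / 8; have u0 : 0 < u by rewrite divr_gt0.
have s0 : 0 < 1 + u by rewrite addr_gt0.
pose h := (1 - (1 + u) ^- 2) / 2.
have Eh : h = (2 * u + u ^+ 2) / (2 * (1 + u) ^+ 2) by rewrite /h; field; rewrite gt_eqF.
have h0 : 0 < h.
  by rewrite Eh divr_gt0 // ?mulr_gt0 ?exprn_gt0 // addr_gt0 ?mulr_gt0 ?exprn_gt0.
have i2 : N.-integrable setT (EFin \o (fun x : R => h * x ^+ 2)).
  by apply: rintZ; exact: integrable_normal_pow.
have i4 : N.-integrable setT (EFin \o (fun x : R => h ^+ 2 / 2 * x ^+ 4)).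
  by apply: rintZ; exact: integrable_normal_pow.
have i12 : N.-integrable setT (EFin \o (fun x : R => 1 + h * x ^+ 2)).
  by apply: rintD => //; exact: rint_cst.
have : 1 + h * nmom 2 + h ^+ 2 / 2 * nmom 4 <= 1 + u.
  rewrite -[leRHS](Rintegral_normal_exp_sqr s0) -/h.
  rewrite -Rintegral_normal_affine /nmom.
  rewrite -(RintegralZl _ measurableT (@integrable_normal_pow 4 isT)).
  rewrite -(RintegralD measurableT i12 i4).
  apply: le_Rintegral => //.
  - exact: rintD.
  - exact: integrable_normal_exp_sqr.
  - move=> x _ /=; have := @expR_ge_quadratic (h * x ^+ 2) (mulr_ge0 (ltW h0) (sqr_ge0 x)).
    by rewrite exprMn -exprM (mulrAC (h ^+ 2)).
rewrite nmom2 mulr1 => k.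
have {}k : h ^+ 2 * nmom 4 <= 2 * (u - h) by lra.
have Eu : e = 8 * u by rewrite /u; field.
have h2 : 0 < h ^+ 2 by rewrite exprn_gt0.
rewrite -(ler_pM2l h2) (le_trans k) // Eu.
have -> : 2 * (u - h) = u ^+ 2 * (3 + 2 * u) / (1 + u) ^+ 2.
  by rewrite Eh; field; rewrite gt_eqF.
have -> : h ^+ 2 * (3 + 8 * u) =
    u ^+ 2 * ((2 + u) ^+ 2 * (3 + 8 * u) / (4 * (1 + u) ^+ 2)) / (1 + u) ^+ 2.
  by rewrite Eh; field; rewrite gt_eqF.
rewrite ler_pM2r ?invr_gt0 ?exprn_gt0 // ler_pM2l ?exprn_gt0 //.
rewrite ler_pdivlMr ?mulr_gt0 ?exprn_gt0 //.
have u2 : 0 < u ^+ 2 by rewrite exprn_gt0.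
have u3 : 0 < u ^+ 3 by rewrite exprn_gt0.
by lra.
Qed.

End NormalMoments.

(** * Independence *)

Section IndependentProduct.
Context (d0 : measure_display) (T : measurableType d0) (R : realType).
Variable P : probability T R.
Local Notation rint f := (P.-integrable setT (EFin \o (f))).

(** Agreement on rectangles makes the joint law of [(F, Y)] the product of the two laws; Tonelli
    gives integrability of [x y] and Fubini splits its integral. *)
Lemma indep_Rintegral_mul (F Y : T -> R) :
  measurable_fun setT F -> measurable_fun setT Y ->
  (forall A B : set R, measurable A -> measurable B ->
     P (F @^-1` A `&` Y @^-1` B) = P (F @^-1` A) * P (Y @^-1` B))%E ->
  rint F -> rint Y ->
  rint (fun t => F t * Y t) /\ \int[P]_t (F t * Y t) = \int[P]_t F t * \int[P]_t Y t.
Proof.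
move=> mF mY ind iF iY.
pose F' : {mfun T >-> R} := mfun_Sub (mem_set mF).
pose Y' : {mfun T >-> R} := mfun_Sub (mem_set mY).
pose m1 := distribution P F'; pose m2 := distribution P Y'.
pose FY (t : T) : R * R := (F t, Y t).
have mFY : measurable_fun setT FY by exact: measurable_fun_pair.
pose FY' : {mfun T >-> _} := mfun_Sub (mem_set mFY).
pose m := distribution P FY'.
have mE X : measurable X -> (m1 \x m2)%E X = m X.
  move=> mX; apply: product_measure_unique; last exact: mX.
  by move=> A B mA mB; exact: ind.
pose f (z : R * R) : \bar R := (z.1 * z.2)%:E.
have mf : measurable_fun setT f.
  by apply/measurable_EFinP; apply: measurable_funM => //.
have mid : measurable_fun setT (EFin : R -> \bar R).
  exact/measurable_EFinP.
have i1 : m1.-integrable setT (EFin : R -> \bar R).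
  exact: integrable_pushforward.
have i2 : m2.-integrable setT (EFin : R -> \bar R).
  exact: integrable_pushforward.
have e1 : (\int[m1]_x x%:E = (\int[P]_t F t)%:E)%E.
  rewrite integral_distribution //= fineK //.
  exact: (integrable_fin_num measurableT iF).
have e2 : (\int[m2]_x x%:E = (\int[P]_t Y t)%:E)%E.
  rewrite integral_distribution //= fineK //.
  exact: (integrable_fin_num measurableT iY).
have ii : (m1 \x m2)%E.-integrable setT f.
  apply/integrable12ltyP => //.
  have -> : (\int[m1]_x \int[m2]_y `|f (x, y)| =
     \int[m1]_x (`|x%:E| * \int[m2]_y `|y%:E|))%E.
    apply: eq_integral => x _.
    rewrite -ge0_integralZl //; last exact: measurableT_comp.
    by apply: eq_integral => y _; rewrite /f /= normrM EFinM.
  have /integrableP[_ l2] := i2; have /integrableP[_ l1] := i1.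
  have g2 : (0 <= \int[m2]_y `|y%:E|)%E by exact: integral_ge0.
  have f2 : (\int[m2]_y `|y%:E|)%E \is a fin_num by rewrite ge0_fin_numE.
  rewrite -(fineK f2) ge0_integralZr ?lee_fin ?fine_ge0 //; last exact: measurableT_comp.
  by rewrite lte_mul_pinfty ?ltry ?ge0_fin_numE ?integral_ge0.
have im : m.-integrable setT f.
  apply/integrableP; split => //; have /integrableP[_] := ii.
  suff -> : (\int[m]_x `|f x| = \int[m1 \x m2]_x `|f x|)%E by [].
  by apply: eq_measure_integral => A mA _; exact/esym/mE.
have iFY : rint (fun t => F t * Y t).
  apply/integrableP; split; first by apply/measurable_EFinP; exact: measurable_funM.
  have /integrableP[_] := im; rewrite ge0_integral_distribution //.
  exact: measurableT_comp.
split => //.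
have : (\int[P]_t (F t * Y t)%:E = \int[m1 \x m2]_z f z)%E.
  transitivity (\int[m]_z f z)%E; first by rewrite integral_distribution.
  by apply: eq_measure_integral => A mA _; exact/esym/mE.
rewrite -integral12_prod_meas1 // /Rintegral => ->.
transitivity (fine (\int[m1]_x (x%:E * (\int[P]_t Y t)%:E))%E).
  congr fine; apply: eq_integral => x _.
  by rewrite -e2 -integralZl //; apply: eq_integral => y _; rewrite /f EFinM.
by rewrite integralZr // e1 -EFinM.
Qed.

End IndependentProduct.

(** * Sigma-algebras generated by part of an independent family *)

Section IndependentFamily.
Context (d0 : measure_display) (T : measurableType d0) (R : realType).
Variables (P : probability T R) (I : finType) (X : I -> T -> R).
Hypothesis mX : forall i, measurable_fun setT (X i).
Hypothesis indX : mutually_independent P X.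
Local Notation rint f := (P.-integrable setT (EFin \o (f))).
Implicit Types J K : {set I}.

(** Cylinder sets over the coordinates in [J]: a pi-system, on which measures can be compared. *)
Definition rects J : set (set T) :=
  [set A | exists2 B : I -> set R, (forall i, measurable (B i)) &
     A = \bigcap_(i in [set i | i \in J]) (X i @^-1` B i)].

(** A copy of [T] with a smaller sigma-algebra, so that measurability on [generated J] expresses
    dependence on the variables in [J] only. *)
Definition generated J := g_sigma_algebraType (rects J).

Lemma rects_measurable J : rects J `<=` measurable.
Proof.
move=> A [B mB ->]; apply: fin_bigcap_measurable; first exact: finite_finset.
by move=> i _; rewrite -[X in measurable X]setTI; exact: mX.
Qed.

Lemma generated_measurable J A : <<s rects J >> A -> measurable A.
Proof.
by apply: smallest_sub; [exact: sigma_algebra_measurable | exact: rects_measurable].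
Qed.

Lemma rects_setI J : setI_closed (rects J).
Proof.
move=> _ _ [B mB ->] [C mC ->]; exists (fun i => B i `&` C i).
  by move=> i; exact: measurableI.
apply/seteqP; split => [t [tB tC] i iJ|t tBC]; first by split; [exact: tB | exact: tC].
by split => i iJ; have [] := tBC i iJ.
Qed.

Lemma rects_setT J : rects J setT.
Proof. by exists (fun=> setT) => //; apply/seteqP; split. Qed.

Lemma rects_sub J K : J \subset K -> rects J `<=` rects K.
Proof.
move=> /fintype.subsetP JK A [B mB ->].
exists (fun i => if i \in J then B i else setT) => [i|]; first by case: ifP.
apply/seteqP; split => [t tB i iK /=|t tB i /= iJ].
  by case: ifPn => // iJ; exact: tB.
by have := tB i (JK i iJ); rewrite /= iJ.
Qed.

Lemma generated_X J i : i \in J -> measurable_fun setT (X i : generated J -> R).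
Proof.
move=> iJ _ B mB; rewrite setTI; apply: sub_sigma_algebra.
exists (fun j => if j == i then B else setT) => [j|]; first by case: ifP.
apply/seteqP; split => [t tB j _ /=|t tB]; first by case: eqP => [->|].
by have := tB i iJ; rewrite /= eqxx.
Qed.

Lemma generated_sub J K (f : T -> R) : J \subset K ->
  measurable_fun setT (f : generated J -> R) ->
  measurable_fun setT (f : generated K -> R).
Proof.
move=> JK mf _ B mB; apply: (sub_sigma_algebra2 (rects_sub JK)).
exact: mf.
Qed.

Lemma generated_meas J (f : T -> R) :
  measurable_fun setT (f : generated J -> R) -> measurable_fun setT f.
Proof. by move=> mf _ B mB; exact: generated_measurable (mf measurableT B mB). Qed.

(** As functions of [A], both sides are finite measures; they agree on the pi-system [rects J],
    hence on the sigma-algebra it generates. *)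
Lemma indep_generated J i (A : set T) (B : set R) : i \notin J ->
  <<s rects J >> A -> measurable B ->
  (P (A `&` X i @^-1` B) = P A * P (X i @^-1` B))%E.
Proof.
move=> iJ GA mB.
have mXB : measurable (X i @^-1` B) by rewrite -[Y in measurable Y]setTI; exact: mX.
have p0 : 0 <= fine (P (X i @^-1` B)) by rewrite fine_ge0.
pose m1 := mrestr P mXB; pose m2 := mscale (NngNum p0) P.
have fP : P (X i @^-1` B) \is a fin_num by rewrite fin_num_measure.
have m2E Y : m2 Y = (P (X i @^-1` B) * P Y)%E by rewrite /m2 /mscale /= fineK.
suff : m1 A = m2 A by rewrite m2E muleC.
apply: (g_sigma_algebra_measure_unique (rects J) (@rects_measurable J) (fun=> setT)) => //.
- by move=> _; exact: rects_setT.
- by rewrite bigcup_const.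
- exact: rects_setI.
- move=> _ [C mC ->]; rewrite -[RHS]/(m2 _) m2E -[LHS]/(P (_ `&` X i @^-1` B)).
  (* Adjoining the side [B] in direction [i] gives a rectangle over [i |: J], to which mutual
     independence applies. *)
  pose D j := if j == i then B else C j.
  have mD j : measurable (D j) by rewrite /D; case: ifP.
  have DC j : j \in J -> D j = C j.
    by move=> jJ; rewrite /D; case: eqP => // ji; rewrite -ji jJ in iJ.
  have := indX (i |: J) mD; rewrite big_setU1 //= {2}/D eqxx.
  rewrite (indX J mC) => h.
  transitivity (P (\bigcap_(j in [set j | j \in i |: J]) (X j @^-1` D j))).
    congr (P _); apply/seteqP; split => [t [tC tB] j /=|t tD].
      by rewrite in_setU1 /D; case: eqP => [-> //|_ /= jJ]; exact: tC.
    split; last by have := tD i (setU11 _ _); rewrite /D eqxx.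
    move=> j jJ; have := tD j; rewrite /= in_setU1 jJ orbT DC //; exact.
  rewrite h; congr (_ * _)%E; apply: eq_bigr => j jJ; by rewrite DC.
- move=> k; apply: (@le_lt_trans _ _ 1%E); last exact: ltry.
  by apply: probability_le1; exact: measurableI.
Qed.

(** By induction on [r]: the first factor is absorbed into [F] while its index joins [J], so that
    the remaining variables are still independent of the new [F]. *)
Lemma indep_monomial J (r : seq I) (F : T -> R) (g : I -> R -> R) : uniq r ->
  {in r, forall i, i \notin J} ->
  measurable_fun setT (F : generated J -> R) -> rint F ->
  (forall i, measurable_fun setT (g i)) -> (forall i, rint (g i \o X i)) ->
  rint (fun t => F t * \prod_(i <- r) g i (X i t)) /\
  \int[P]_t (F t * \prod_(i <- r) g i (X i t)) =
  \int[P]_t F t * \prod_(i <- r) \int[P]_t g i (X i t).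
Proof.
move=> + + + + mg ig; elim: r J F => [|i r IH] J F /=.
  move=> _ _ mF iF; rewrite big_nil mulr1.
  by under eq_fun do rewrite big_nil mulr1.
move=> /andP[ir ur] rJ mF iF.
have iJ : i \notin J by apply: rJ; rewrite mem_head.
have mFT := generated_meas mF.
have mgX : measurable_fun setT (g i \o X i) by exact: measurableT_comp.
have [iFg eFg] : rint (fun t => F t * g i (X i t)) /\
    \int[P]_t (F t * g i (X i t)) = \int[P]_t F t * \int[P]_t g i (X i t).
  apply: (indep_Rintegral_mul mFT mgX _ iF (ig i)) => A B mA mB.
  have GA : <<s rects J >> (F @^-1` A) by rewrite -[Y in <<s _ >> Y]setTI; exact: mF.
  rewrite comp_preimage; apply: (indep_generated iJ GA).
  by rewrite -[Y in measurable Y]setTI; exact: mg.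
have := IH (i |: J) (fun t => F t * g i (X i t)) ur.
move=> /(_ _ _ iFg) [|| h1 h2].
- move=> k kr; rewrite in_setU1 negb_or rJ ?in_cons ?kr ?orbT // andbT.
  by apply: contraNneq ir => <-.
- apply: measurable_funM; first exact: (generated_sub (finset.subsetUr _ _) mF).
  by apply: measurableT_comp => //; apply: generated_X; exact: setU11.
have eF : (fun t => F t * \prod_(k <- i :: r) g k (X k t)) =
    (fun t => F t * g i (X i t) * \prod_(k <- r) g k (X k t)).
  by apply/funext => t; rewrite big_cons mulrA.
by rewrite eF; split => //; rewrite h2 eFg big_cons mulrA.
Qed.

End IndependentFamily.

(** * Fourth moments of a Gaussian column *)

Section GaussianMoments.
Variables (R : realType) (d : nat).
Implicit Types j k l m : 'I_d.

(** The exponent of the variable [a] in the monomial [x p.1 * x p.2]. *)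
Definition mult2 (p : 'I_d * 'I_d) (a : 'I_d) : nat := (a == p.1) + (a == p.2).

Lemma prod_expr_eq (x : 'I_d -> R) j : \prod_a x a ^+ (a == j) = x j.
Proof.
by rewrite (bigD1 j) //= eqxx expr1 big1 ?mulr1 // => a /negbTE ->.
Qed.

Lemma prod_expr_mult2 (x : 'I_d -> R) p :
  \prod_a x a ^+ mult2 p a = x p.1 * x p.2.
Proof.
rewrite -(prod_expr_eq x p.1) -(prod_expr_eq x p.2) -big_split /=.
by apply: eq_bigr => a _; rewrite -exprD.
Qed.

Lemma prod_eq1 (f : 'I_d -> R) (a : 'I_d) : (forall b, b != a -> f b = 1) ->
  \prod_b f b = f a.
Proof. by move=> h; rewrite (bigD1 a) //= big1 ?mulr1. Qed.

Lemma prod_eq2 (f : 'I_d -> R) (a b : 'I_d) : a != b ->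
  (forall c, c != a -> c != b -> f c = 1) -> \prod_c f c = f a * f b.
Proof.
move=> ab h; rewrite (bigD1 a) //= (bigD1 b) 1?eq_sym //= big1 ?mulr1 //.
by move=> c /andP[ca cb]; exact: h.
Qed.

Lemma prod_eq0 (f : 'I_d -> R) (a : 'I_d) : f a = 0 -> \prod_c f c = 0.
Proof. by move=> h; rewrite (bigD1 a) //= h mul0r. Qed.

Let nm1 : nmom R 1 = 0. Proof. exact: nmom_odd. Qed.

Lemma wick2 p : \prod_a nmom R (mult2 p a) = (p.1 == p.2)%:R.
Proof.
case: p => j k /=; have [->|jk] := eqVneq j k.
  rewrite (@prod_eq1 _ k); first by rewrite /mult2 /= eqxx nmom2.
  by move=> b /negbTE bk; rewrite /mult2 /= bk nmom0.
by apply: (@prod_eq0 _ j); rewrite /mult2 /= eqxx (negbTE jk) nm1.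
Qed.

Local Ltac neq_simp := repeat match goal with
  | H : is_true (?a != ?b) |- context [?a == ?b] => rewrite (negbTE H)
  | H : is_true (?a != ?b) |- context [?b == ?a] => rewrite (eq_sym b a) (negbTE H)
  end; rewrite ?eqxx /= ?addn0 ?add0n.

(** The three pairings of Wick's formula count a fourfold index as 3; the last term corrects this to
    the fourth moment. Whenever no pairing exists, some index occurs exactly once and the product
    vanishes. *)
Lemma wick4 p q : \prod_a nmom R (mult2 p a + mult2 q a) =
  (p.1 == p.2)%:R * (q.1 == q.2)%:R
  + (p.1 == q.1)%:R * (p.2 == q.2)%:R + (p.1 == q.2)%:R * (p.2 == q.1)%:R
  + (nmom R 4 - 3) * ((p.1 == p.2) && (q.1 == q.2) && (p.1 == q.1))%:R.
Proof.
case: p q => j k [l m]; rewrite /mult2 /=.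
case: (eqVneq j k) => [jk|jk]; [subst k|].
  case: (eqVneq l m) => [lm|lm]; [subst m|].
    case: (eqVneq j l) => [jl|jl]; [subst l|].
      rewrite (@prod_eq1 _ j); first by neq_simp; ring.
      by move=> b bj; neq_simp; rewrite nmom0.
    rewrite (@prod_eq2 _ j l) //; first by neq_simp; rewrite nmom2; ring.
    by move=> c cj cl; neq_simp; rewrite nmom0.
  case: (eqVneq j l) => [jl|jl]; [subst l|].
    by rewrite (@prod_eq0 _ m); neq_simp; [ring | rewrite nm1].
  by rewrite (@prod_eq0 _ l); neq_simp; [ring | rewrite nm1].
case: (eqVneq j l) => [jl|jl]; [subst l|].
  case: (eqVneq k m) => [km|km]; [subst m|].
    rewrite (@prod_eq2 _ j k) //; first by neq_simp; rewrite nmom2; ring.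
    by move=> c cj ck; neq_simp; rewrite nmom0.
  by rewrite (@prod_eq0 _ k); neq_simp; [ring | rewrite nm1].
case: (eqVneq k l) => [kl|kl]; [subst l|].
  case: (eqVneq j m) => [jm|jm]; [subst m|].
    rewrite (@prod_eq2 _ j k) //; first by neq_simp; rewrite nmom2; ring.
    by move=> c cj ck; neq_simp; rewrite nmom0.
  by rewrite (@prod_eq0 _ j); neq_simp; [ring | rewrite nm1].
case: (eqVneq l m) => [lm|lm]; [subst m|].
  by rewrite (@prod_eq0 _ j); neq_simp; [ring | rewrite nm1].
by rewrite (@prod_eq0 _ l); neq_simp; [ring | rewrite nm1].
Qed.

End GaussianMoments.

(** * Expectations of one and of two quadratic forms *)

Section WickSums.
Variables (R : realType) (d : nat).
Implicit Types A B : 'M[R]_d.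

Lemma sum_pick (I : finType) (f : I -> R) (i : I) :
  \sum_j f j * (i == j)%:R = f i.
Proof.
rewrite (bigD1 i) //= eqxx mulr1 big1 ?addr0 // => j /negbTE ji.
by rewrite eq_sym ji mulr0.
Qed.

Lemma wick2_sum A :
  \sum_(p : 'I_d * 'I_d) A p.1 p.2 * \prod_a nmom R (mult2 p a) = \tr A.
Proof.
under eq_bigr do rewrite wick2.
rewrite -(pair_bigA _ (fun j k => A j k * (j == k)%:R)) /=.
by apply: eq_bigr => j _; rewrite sum_pick.
Qed.

(** The sum is [tr A tr B + 2 tr (A B) + (m - 3) sum A_jj B_jj], with [m] the fourth moment. The
    first two traces are at most 1 under the hypotheses, and [m <= 3] makes the last term
    nonpositive. *)
Lemma wick4_sum_le A B : psd A -> psd B -> \tr A <= 1 -> \tr B <= 1 ->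
  \sum_(x : ('I_d * 'I_d) * ('I_d * 'I_d))
     A x.1.1 x.1.2 * B x.2.1 x.2.2 * \prod_a nmom R (mult2 x.1 a + mult2 x.2 a) <= 3.
Proof.
move=> pA pB tA tB.
have tA0 := psd_tr_ge0 pA; have tB0 := psd_tr_ge0 pB.
pose fr (M : 'M[R]_d) := \sum_(p : 'I_d * 'I_d) M p.1 p.2 ^+ 2.
have frE M : psd M -> \tr M <= 1 -> fr M <= 1.
  move=> pM tM; have tM0 := psd_tr_ge0 pM.
  rewrite /fr -(pair_bigA _ (fun j k => M j k ^+ 2)) /= -sym_tr_sqr ?(proj1 pM) //.
  by rewrite (le_trans (psd_tr_sqr_le pM)) // exprn_ile1.
pose t1 := \sum_(p : 'I_d * 'I_d) \sum_(q : 'I_d * 'I_d)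
   (A p.1 p.2 * (p.1 == p.2)%:R) * (B q.1 q.2 * (q.1 == q.2)%:R).
pose t2 := \sum_(p : 'I_d * 'I_d) A p.1 p.2 * B p.1 p.2.
have t1E : t1 = \tr A * \tr B.
  rewrite /t1 -big_distrlr /=; congr (_ * _); rewrite -wick2_sum;
  by apply: eq_bigr => p _; rewrite wick2.
have t2E : t2 <= 1.
  have : 2 * t2 <= fr A + fr B.
    rewrite /t2 /fr mulr_sumr -big_split /=; apply: ler_sum => p _.
    by have := sqr_ge0 (A p.1 p.2 - B p.1 p.2); lra.
  by have := frE A pA tA; have := frE B pB tB; lra.
have t1_le : t1 <= 1 by rewrite t1E mulr_ile1.
suff h : \sum_(p : 'I_d * 'I_d) \sum_(q : 'I_d * 'I_d)
    A p.1 p.2 * B q.1 q.2 * \prod_a nmom R (mult2 p a + mult2 q a) <= t1 + t2 + t2.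
  rewrite -(pair_bigA _ (fun p q : 'I_d * 'I_d =>
    A p.1 p.2 * B q.1 q.2 * \prod_a nmom R (mult2 p a + mult2 q a))) /=.
  by lra.
rewrite {1}/t1 /t2 -!big_split /=; apply: ler_sum => -[j k] _ /=.
have sB : B j k = B k j by rewrite -[in LHS](proj1 pB) mxE.
have e2 : A j k * B j k =
    \sum_(q : 'I_d * 'I_d) A j k * B q.1 q.2 * ((j == q.1)%:R * (k == q.2)%:R).
  rewrite -(sum_pick (fun q : 'I_d * 'I_d => A j k * B q.1 q.2) (j, k)) /=.
  by apply: eq_bigr => -[l m] _; rewrite -natrM mulnb.
have e3 : A j k * B j k =
    \sum_(q : 'I_d * 'I_d) A j k * B q.1 q.2 * ((j == q.2)%:R * (k == q.1)%:R).
  rewrite sB -(sum_pick (fun q : 'I_d * 'I_d => A j k * B q.1 q.2) (k, j)) /=.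
  by apply: eq_bigr => -[l m] _; rewrite -natrM mulnb andbC.
rewrite {1}e2 e3 -!big_split /=; apply: ler_sum => -[l m] _ /=.
rewrite wick4 /=.
suff : (nmom R 4 - 3) * (A j k * B l m * ((j == k) && (l == m) && (j == l))%:R) <= 0.
  by lra.
rewrite mulr_le0_ge0 // ?subr_le0 ?nmom4_le3 //.
case: (eqVneq j k) => [<-|_] /=; last by rewrite mulr0.
case: (eqVneq l m) => [<-|_] /=; last by rewrite mulr0.
by rewrite !mulr_ge0 ?psd_diag_ge0.
Qed.

End WickSums.

(** * Measurability *)

Section MatrixMeasurability.
Context (d0 : measure_display) (T : measurableType d0) (R : realType).

Definition mxmeas m n (A : T -> 'M[R]_(m, n)) : Prop :=
  forall i j, measurable_fun setT (fun t => A t i j).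

(** Writing [x^-1 = x (x^2)^-1] reduces to a real power of a nonnegative base; the identity persists
    at 0, where [0^-1 = 0]. *)
Lemma measurable_funV (f : T -> R) : measurable_fun setT f ->
  measurable_fun setT (fun t => (f t)^-1).
Proof.
move=> mf.
have -> : (fun t => (f t)^-1) = (fun t => f t * (f t ^+ 2) `^ (-1)).
  apply/funext => t; rewrite powR_inv1 ?sqr_ge0 //.
  have [->|f0] := eqVneq (f t) 0; first by rewrite mul0r invr0.
  by field.
apply: measurable_funM => //; apply: (measurableT_comp (measurable_powR (-1))).
exact: measurable_funX.
Qed.

Lemma mxmeas_cst m n (A : 'M[R]_(m, n)) : mxmeas (fun=> A).
Proof. by move=> i j; exact: measurable_cst. Qed.

Lemma mxmeasM m n p (A : T -> 'M[R]_(m, n)) (B : T -> 'M[R]_(n, p)) :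
  mxmeas A -> mxmeas B -> mxmeas (fun t => A t *m B t).
Proof.
move=> mA mB i j; under eq_fun do rewrite mxE.
by apply: measurable_sum => k; exact: measurable_funM.
Qed.

Lemma mxmeasT m n (A : T -> 'M[R]_(m, n)) : mxmeas A -> mxmeas (fun t => (A t)^T).
Proof. by move=> mA i j; under eq_fun do rewrite mxE; exact: mA. Qed.

Lemma mxmeasB m n (A B : T -> 'M[R]_(m, n)) :
  mxmeas A -> mxmeas B -> mxmeas (fun t => A t - B t).
Proof.
move=> mA mB i j; under eq_fun do rewrite !mxE.
exact: measurable_funB.
Qed.

Lemma mxmeasZ m n (a : T -> R) (A : T -> 'M[R]_(m, n)) :
  measurable_fun setT a -> mxmeas A -> mxmeas (fun t => a t *: A t).
Proof.
move=> ma mA i j; under eq_fun do rewrite !mxE.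
exact: measurable_funM.
Qed.

Lemma measurable_mxtrace n (A : T -> 'M[R]_n) : mxmeas A ->
  measurable_fun setT (fun t => \tr (A t)).
Proof. by move=> mA; apply: measurable_sum => i; exact: mA. Qed.

Lemma measurable_det n (A : T -> 'M[R]_n) : mxmeas A ->
  measurable_fun setT (fun t => \det (A t)).
Proof.
move=> mA; apply: measurable_sum => s.
by apply: measurable_funM => //; apply: measurable_prod => i _; exact: mA.
Qed.

Lemma mxmeas_invmx n (A : T -> 'M[R]_n) : (forall t, A t \in unitmx) ->
  mxmeas A -> mxmeas (fun t => invmx (A t)).
Proof.
move=> uA mA i j.
have -> : (fun t => invmx (A t) i j) =
    (fun t => (\det (A t))^-1 * ((-1) ^+ (j + i) * \det (row' j (col' i (A t))))).
  by apply/funext => t; rewrite /invmx uA !mxE.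
apply: measurable_funM; first by apply: measurable_funV; exact: measurable_det.
apply: measurable_funM => //; apply: measurable_det => k l.
by under eq_fun do rewrite !mxE; exact: mA.
Qed.

Lemma measurable_bform n (A : T -> 'M[R]_n) (v : T -> 'cV[R]_n) :
  mxmeas A -> mxmeas v -> measurable_fun setT (fun t => bform (A t) (v t) (v t)).
Proof. by move=> mA mv; apply: mxmeasM => //; apply: mxmeasM => //; exact: mxmeasT. Qed.

Lemma mxmeas_deflate n (C : T -> 'M[R]_n) (w : T -> 'cV[R]_n) :
  mxmeas C -> mxmeas w -> mxmeas (fun t => deflate (C t) (w t)).
Proof.
move=> mC mw; apply: mxmeasB => //; apply: mxmeasZ.
  by apply: measurable_funV; exact: measurable_bform.
by apply: mxmeasM; [exact: mxmeasM | apply: mxmeasT; exact: mxmeasM].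
Qed.

Lemma measurable_bshift n (C : T -> 'M[R]_n) (w : T -> 'cV[R]_n) :
  mxmeas C -> mxmeas w -> measurable_fun setT (fun t => bshift (C t) (w t)).
Proof.
move=> mC mw; apply: measurable_funM => //; apply: measurable_funM.
  by apply: measurable_bform => //; exact: mxmeasM.
apply: measurable_funV; apply: measurable_funM; first exact: measurable_bform.
by apply: measurable_mxtrace; exact: mxmeasM.
Qed.

Lemma mxmeas_barrier_step n (C : T -> 'M[R]_n) (w : T -> 'cV[R]_n) :
  (forall t, psd (C t)) -> mxmeas C -> mxmeas w ->
  mxmeas (fun t => barrier_step (C t) (w t)).
Proof.
move=> pC mC mw; have mD := mxmeas_deflate mC mw.
apply: mxmeasM => //; apply: mxmeas_invmx.
  by move=> t; have [] := barrier_step_props (w t) (pC t).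
apply: mxmeasB; first exact: mxmeas_cst.
by apply: mxmeasZ => //; exact: measurable_bshift.
Qed.

End MatrixMeasurability.

(** * Integrating out one Gaussian column *)

Section GaussianColumns.
Context (d0 : measure_display) (T : measurableType d0) (R : realType).
Variables (Pr : probability T R) (d s : nat) (Om : T -> 'M[R]_(d, s)).
Hypothesis gOm : iid_std_gaussian Pr Om.
Local Notation rint f := (Pr.-integrable setT (EFin \o (f))).

Definition entry (p : 'I_d * 'I_s) (t : T) : R := Om t p.1 p.2.
Definition past (k : nat) : {set 'I_d * 'I_s} := [set p : 'I_d * 'I_s | (p.2 < k)%N]%SET.

Let mX p : measurable_fun setT (entry p).
Proof. by case: gOm => h _ _; exact: h. Qed.

Lemma gaussian_pow p k : (k <= 4)%N ->
  rint (fun t => entry p t ^+ k) /\ \int[Pr]_t entry p t ^+ k = nmom R k.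
Proof.
move=> k4; have mXp : @measurable_fun _ _ T (measurableTypeR R) setT (entry p) by exact: mX.
pose X' : {mfun T >-> measurableTypeR R} := MeasurableFun.Pack (MeasurableFun.Class
  (@isMeasurableFun.Build _ _ T (measurableTypeR R) (entry p) mXp)).
have mk : measurable_fun setT (fun x : measurableTypeR R => (x ^+ k)%:E).
  by apply/measurable_EFinP; exact: measurable_funX.
have law A : measurable A -> distribution Pr X' A = normal_prob 0 1 A.
  by move=> mA; case: gOm => _ h _; exact: h.
have ik := integrable_normal_pow R k4.
have i : rint (fun t => entry p t ^+ k).
  apply/integrableP; split; first by apply/measurable_EFinP; exact: measurable_funX.
  have := @ge0_integral_distribution _ _ _ _ _ Pr X' (fun x => `|(x ^+ k)%:E|)%E.
  move=> /(_ (measurableT_comp _ mk)) <- //.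
  have /integrableP[_] := ik; congr (_ < _)%E.
  by apply: eq_measure_integral => A mA _; exact/esym/law.
split => //; rewrite /nmom /Rintegral; congr fine.
rewrite -(@integral_distribution _ _ _ _ _ Pr X' (fun x => (x ^+ k)%:E)) //.
by apply: eq_measure_integral => A mA _; exact: law.
Qed.

(** Plays the role of a conditional expectation given the earlier columns: the coefficients depend
    on these alone, so each monomial of column [j] is replaced by its Gaussian moment. *)
Lemma column_poly (j : 'I_s) (K : finType) (G : K -> T -> R) (e : K -> 'I_d -> nat) :
  (forall k a, e k a <= 4)%N ->
  (forall k, measurable_fun setT (G k : generated entry (past j) -> R)) ->
  (forall k, rint (G k)) ->
  rint (fun t => \sum_k G k t * \prod_a Om t a j ^+ e k a) /\
  \int[Pr]_t (\sum_k G k t * \prod_a Om t a j ^+ e k a) =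
  \int[Pr]_t (\sum_k G k t * \prod_a nmom R (e k a)).
Proof.
move=> e4 mG iG.
have one k : rint (fun t => G k t * \prod_a Om t a j ^+ e k a) /\
    \int[Pr]_t (G k t * \prod_a Om t a j ^+ e k a) =
    \int[Pr]_t (G k t * \prod_a nmom R (e k a)).
  pose r := [seq (a, j) | a <- index_enum 'I_d].
  pose g (p : 'I_d * 'I_s) (x : R) := x ^+ e k p.1.
  have indX : mutually_independent Pr entry by case: gOm.
  have ur : uniq r by rewrite map_inj_uniq ?index_enum_uniq // => a b [].
  have rJ : {in r, forall p, p \notin past j}.
    by move=> _ /mapP[a _ ->]; rewrite inE /= ltnn.
  have mg p : measurable_fun setT (g p) by exact: measurable_funX.
  have ig p : rint (g p \o entry p) by have [] := gaussian_pow p (e4 k p.1).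
  have [h1 h2] := indep_monomial mX indX ur rJ (mG k) (iG k) mg ig.
  have eF t : G k t * \prod_(p <- r) g p (entry p t) =
      G k t * \prod_a Om t a j ^+ e k a by rewrite big_map.
  have eF' := funext eF; rewrite /= in eF'.
  rewrite -eF'; split => //.
  rewrite h2 RintegralZr //; congr (_ * _); rewrite big_map.
  by apply: eq_bigr => a _; have [] := gaussian_pow (a, j) (e4 k a).
split; first by apply: rint_sum => k; have [] := one k.
rewrite !Rintegral_sum.
- by apply: eq_bigr => k _; have [] := one k.
- by move=> k; under eq_fun do rewrite mulrC; exact: rintZ.
- by move=> k; have [] := one k.
Qed.

End GaussianColumns.

(** * The barrier process *)

Section BarrierProcess.
Variables (R : realType) (d s : nat).
Implicit Types (Om : 'M[R]_(d, s)) (C : 'M[R]_d) (w z : 'cV[R]_d).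

(* Column [k] of [Om], and [0] when [k] is out of range. *)
Definition coln Om (k : nat) : 'cV[R]_d := if insub k is Some j then col j Om else 0.

Fixpoint barrier C Om k : 'M[R]_d :=
  if k is k'.+1 then barrier_step (barrier C Om k') (coln Om k') else C.

Fixpoint level C Om k : R :=
  if k is k'.+1 then level C Om k' + bshift (barrier C Om k') (coln Om k') else 0.

Lemma barrier_psd C Om k : psd C -> psd (barrier C Om k).
Proof.
move=> pC; elim: k => //= k IH.
by have [] := barrier_step_props (coln Om k) IH.
Qed.

Lemma barrier_tr C Om k : psd C -> \tr (barrier C Om k) <= \tr C.
Proof.
move=> pC; elim: k => //= k IH.
have [_ _ h _] := barrier_step_props (coln Om k) (barrier_psd Om k pC).
exact: le_trans h IH.
Qed.

Lemma level_ge0 C Om k : psd C -> 0 <= level C Om k.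
Proof.
move=> pC; elim: k => //= k IH; rewrite addr_ge0 // bshift_ge0 //.
exact: barrier_psd.
Qed.

(** The vector [z = C w] is orthogonal to every column of [Om], so each step preserves the relation
    [C_k u = z] after subtracting its shift times [z] from [u]. *)
Lemma barrier_ker C Om k w : psd C -> Om^T *m (C *m w) = 0 ->
  barrier C Om k *m (w - level C Om k *: (C *m w)) = C *m w.
Proof.
move=> pC wz; elim: k => [|k IH] /=; first by rewrite scale0r subr0.
have [_ _ _ h] := barrier_step_props (coln Om k) (barrier_psd Om k pC).
rewrite scalerDl opprD addrA; apply: h => //.
rewrite /coln; case: insubP => [j _ _|_]; last by rewrite bform0l.
rewrite /bform mulmx1 tr_col -row_mul wz !mxE //.
Qed.

(** With [z = C w], [u = w - c z] and [C_k u = z], positivity of [C_k] reads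
    [0 <= <u, z> = <w, z> - c |z|^2]. *)
Lemma barrier_bound C Om k w : psd C -> Om^T *m (C *m w) = 0 ->
  level C Om k * bform 1%:M (C *m w) (C *m w) <= bform 1%:M w (C *m w).
Proof.
move=> pC wz; have [_ p0] := barrier_psd Om k pC.
have := p0 (w - level C Om k *: (C *m w)).
rewrite -/(bform _ _ _) bform1E barrier_ker // bformDl bformNl bformZl.
by rewrite subr_ge0.
Qed.

End BarrierProcess.

(** * Starting matrix of the barrier and the kernel estimate *)

Section EffectiveDimension.
Variables (R : realType) (d : nat) (H : 'M[R]_d) (rho : R).
Hypotheses (pH : psd H) (rho0 : 0 < rho).

Definition smoothing : 'M[R]_d := H *m invmx (H + rho%:M).

Lemma shifted_unitmx : H + rho%:M \in unitmx.
Proof.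
apply: (pos_unitmx rho0) => v; rewrite bformD bform_scalar lerDr.
exact: (proj2 pH).
Qed.

(** At [v = (H + rho) y] the form equals [|H y|^2 + rho <y, H y>]. *)
Lemma smoothing_psd : psd smoothing.
Proof.
have uM := shifted_unitmx; have [sH p0] := pH; rewrite /smoothing.
set M := H + rho%:M.
have sM : M^T = M by rewrite /M linearD /= sH tr_scalar_mx.
have cM : H *m M = M *m H by rewrite /M mulmxDr mulmxDl scalar_mxC.
have cK : H *m invmx M = invmx M *m H.
  by rewrite -[RHS](mulmxK uM) -(mulmxA (invmx M)) cM mulKmx.
split; first by rewrite trmx_mul invmx_sym // sH -cK.
move=> v; rewrite -/(bform _ _ _).
set y := invmx M *m v.
have -> : bform (H *m invmx M) v v = bform 1%:M (H *m y) (H *m y) + rho * bform H y y.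
  rewrite bformM sH -/y; have {1}-> : v = M *m y by rewrite mulKVmx.
  rewrite mulmxA cM -mulmxA /M mulmxDl mul_scalar_mx bformDl bformZl.
  rewrite !(bform1C _ y) -!bform1E (bform_sym _ (H *m y) sH).
  by rewrite (bform1E H (H *m y)).
by apply: addr_ge0; [exact: bform1_ge0 | apply: mulr_ge0; [exact: ltW | exact: p0]].
Qed.

(** The barrier is applied at [x = (H + rho) w], where the smoothed vector is [H w]; it gives
    [c |H w|^2 <= |H w|^2 + rho <w, H w>]. The constant 48/7 is the inverse of [55/48 - 1]. If the
    final trace is 0, the final matrix vanishes and so does [H w]. *)
Lemma smoothing_kernel_bound s (Om : 'M[R]_(d, s)) k (w : 'cV[R]_d) :
  \tr (barrier smoothing Om k) = 0 \/ 55 / 48 <= level smoothing Om k ->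
  Om^T *m (H *m w) = 0 ->
  bform 1%:M (H *m w) (H *m w) <= 48 / 7 * rho * bform H w w.
Proof.
move=> good kw; have uM := shifted_unitmx; have [sH p0] := pH.
set x := (H + rho%:M) *m w.
have Cx : smoothing *m x = H *m w by rewrite /smoothing /x -mulmxA mulKmx.
have := @barrier_bound _ _ _ smoothing Om k x smoothing_psd.
rewrite Cx => /(_ kw) hb.
have ex : bform 1%:M x (H *m w) = bform 1%:M (H *m w) (H *m w) + rho * bform H w w.
  by rewrite /x mulmxDl mul_scalar_mx bformDl bformZl -(bform1E H w w).
rewrite ex in hb.
have w0 : 0 <= rho * bform H w w by apply: mulr_ge0; [exact: ltW | exact: p0].
have z0 := bform1_ge0 (H *m w).
case: good => [tr0|c].
  have C0 := psd_tr_eq0 (barrier_psd Om k smoothing_psd) tr0.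
  have := @barrier_ker _ _ _ smoothing Om k x smoothing_psd.
  rewrite Cx => /(_ kw); rewrite C0 mul0mx => <-.
  by rewrite bform0l -mulrA mulr_ge0.
have : 55 / 48 * bform 1%:M (H *m w) (H *m w) <=
    level smoothing Om k * bform 1%:M (H *m w) (H *m w) by rewrite ler_wpM2r.
by lra.
Qed.

Lemma eff_dim_ge0 : 0 <= eff_dim H rho.
Proof. exact: psd_tr_ge0 smoothing_psd. Qed.

End EffectiveDimension.

(** * Polynomial majorant for one step *)

Section StepWeight.
Variables (R : realType) (n : nat).
Implicit Types (C : 'M[R]_n) (w : 'cV[R]_n).

(* [1] if [C] has nonzero trace and [0] otherwise, thanks to [0^-1 = 0]. *)
Definition alive C : R := \tr C / \tr C.

Lemma aliveP C : alive C = (\tr C != 0)%:R.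
Proof.
by rewrite /alive; have [->|h] := eqVneq (\tr C) 0; rewrite ?mul0r ?divff.
Qed.

Definition sqr_normalized C : 'M[R]_n := (\tr (C *m C))^-1 *: (C *m C).
Definition normalized C : 'M[R]_n := (\tr C)^-1 *: C.

Lemma psdZ (a : R) C : 0 <= a -> psd C -> psd (a *: C).
Proof.
move=> a0 [sC p0]; split; first by rewrite linearZ /= sC.
by move=> v; rewrite -/(bform _ _ _) bformZ mulr_ge0 // p0.
Qed.

Lemma div_le1 (x : R) : x^-1 * x <= 1.
Proof. by have [->|x0] := eqVneq x 0; rewrite ?mulr0 ?ler01 ?mulVf. Qed.

Lemma normalized_psd C : psd C -> psd (normalized C) /\ \tr (normalized C) <= 1.
Proof.
move=> pC; split; first by apply: psdZ => //; rewrite invr_ge0 psd_tr_ge0.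
by rewrite mxtraceZ div_le1.
Qed.

Lemma sqr_normalized_psd C : psd C ->
  psd (sqr_normalized C) /\ \tr (sqr_normalized C) <= 1.
Proof. by move=> [sC _]; apply: normalized_psd; exact: sqr_psd. Qed.

Lemma alive_sqr_normalized C : psd C -> alive C * \tr (sqr_normalized C) = alive C.
Proof.
move=> pC; rewrite aliveP; have [_|t0] := eqVneq (\tr C) 0; first by rewrite mul0r.
rewrite mul1r mxtraceZ mulVf //; apply: contraNneq t0 => /(sym_tr_sqr_eq0 (proj1 pC)) ->.
by rewrite mxtrace0.
Qed.

(** A majorant of [exp (- a / (3 b))] for [b > 0], of degree at most two in the quadratic forms, so
    that Gaussian moments up to order four determine its mean. *)
Definition step_poly C w : R :=
  let a := bform (sqr_normalized C) w w in let b := bform (normalized C) w w in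
  1 - a / 6 + a * b / 48 + a * a / 144.

(* [exp (- a / 3b) <= 1 / (1 + a / 3b) = 1 - a / (3b + a)], and the last
   fraction is bounded below by its tangent at [3b + a = 12]. *)
Lemma exp_ratio_le (a b y : R) : 0 <= a -> 0 < b -> a / (3 * b) <= y ->
  expR (- y) <= 1 - a / 6 + a * b / 48 + a * a / 144.
Proof.
move=> a0 b0 h; have x0 : 0 < 3 * b + a by rewrite ltr_pwDl // mulr_gt0.
have y0 : 0 <= a / (3 * b) by rewrite divr_ge0 // mulr_ge0 // ltW.
apply: (@le_trans _ _ (1 - a / (3 * b + a))).
  have -> : 1 - a / (3 * b + a) = (1 + a / (3 * b))^-1.
    by field; rewrite !gt_eqF //= ?addr_gt0 //; lra.
  rewrite expRN lef_pV2 ?posrE ?expR_gt0 ?ltr_pwDl //.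
  by rewrite (le_trans _ (expR_ge1Dx y)) // lerD2l.
have : a * (2 / 12 - (3 * b + a) / 144) <= a * (3 * b + a)^-1.
  rewrite ler_wpM2l // -(ler_pM2r x0) mulVf ?gt_eqF //.
  by have := sqr_ge0 (3 * b + a - 12); lra.
by lra.
Qed.

(** The constants 5/12 and 4/5 multiply to 1/3, so the exponent is at least [a / (3 b)] for the
    normalized forms, because [k] is at least the trace used to normalize [C]. *)
Lemma step_weight_le C w (k : R) : psd C -> \tr C <= k ->
  alive (barrier_step C w) * expR (- (5 / 12 * k * bshift C w))
   <= alive C * step_poly C w.
Proof.
move=> pC tk; have [sC p0] := pC.
have [_ pC' tC' _] := barrier_step_props w pC.
have tC0 := psd_tr_ge0 pC; rewrite [alive C]aliveP.
(* Zero trace is absorbing, since the trace does not increase. *)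
have [t0|tn0] := eqVneq (\tr C) 0.
  have : \tr (barrier_step C w) = 0.
    by apply/eqP; rewrite eq_le psd_tr_ge0 // -{1}t0 tC'.
  by rewrite /alive => ->; rewrite !mul0r.
have tp : 0 < \tr C by rewrite lt_def tn0.
have qn0 : \tr (C *m C) != 0.
  by apply: contraNneq tn0 => /(sym_tr_sqr_eq0 sC) ->; rewrite mxtrace0.
have qp : 0 < \tr (C *m C) by rewrite lt_def qn0 sym_tr_sqr_ge0.
apply: (@le_trans _ _ (expR (- (5 / 12 * k * bshift C w)))).
  by rewrite ler_piMl ?expR_ge0 // aliveP lern1 leq_b1.
rewrite mul1r /step_poly /sqr_normalized /normalized !bformZ /bshift.
have Cw0 : 0 <= bform C w w by exact: p0.
have CCw0 : 0 <= bform (C *m C) w w by exact: (proj2 (sqr_psd sC)).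
(* Then [C w = 0], the shift is 0 and both sides equal 1. *)
have [b0|bn0] := eqVneq (bform C w w) 0.
  have -> : bform (C *m C) w w = 0.
    by rewrite bformM sC (psd_bform_eq0 pC b0) bform0l.
  by rewrite !(mul0r, mulr0, oppr0, expR0, addr0).
have bp : 0 < bform C w w by rewrite lt_def bn0.
apply: exp_ratio_le.
- by rewrite mulr_ge0 // invr_ge0 ltW.
- by rewrite mulr_gt0 // invr_gt0.
set a := bform (C *m C) w w; set b := bform C w w; set q := \tr (C *m C).
have -> : q^-1 * a / (3 * ((\tr C)^-1 * b)) = \tr C * (a / (3 * b * q)).
  by field; rewrite !gt_eqF.
have -> : 5 / 12 * k * (4 / 5 * (a / (b * q))) = k * (a / (3 * b * q)).
  by field; rewrite !gt_eqF.
by rewrite ler_wpM2r // divr_ge0 // !mulr_ge0 // ltW.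
Qed.

End StepWeight.

(** * Exponential decay of the failure probability *)

Section FailureProbability.
Context (d0 : measure_display) (T : measurableType d0) (R : realType).
Variables (Pr : probability T R) (d s : nat) (Om : T -> 'M[R]_(d, s)).
Hypothesis gOm : iid_std_gaussian Pr Om.
Variable C0 : 'M[R]_d.
Hypothesis pC0 : psd C0.
Local Notation rint f := (Pr.-integrable setT (EFin \o (f))).
Local Notation gen k := (generated (entry Om) (past d s k)).

Let C k t := barrier C0 (Om t) k.
Let pC k t : psd (C k t). Proof. exact: barrier_psd. Qed.

Lemma past_leq j k : (j <= k)%N -> past d s j \subset past d s k.
Proof.
by move=> jk; apply/fintype.subsetP => p; rewrite !inE => /leq_trans; apply.
Qed.

Lemma generated_coln k : mxmeas (fun t : gen k.+1 => coln (Om t) k).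
Proof.
move=> a b; rewrite /coln; case: insubP => [j _ jk|_].
  under eq_fun do rewrite mxE.
  by apply: (@generated_X _ _ _ _ (entry Om) _ (a, j)); rewrite inE /= jk.
by under eq_fun do rewrite mxE; exact: measurable_cst.
Qed.

Lemma generated_barrier k : mxmeas (fun t : gen k => C k t).
Proof.
elim: k => [|k IH]; first exact: mxmeas_cst.
apply: (@mxmeas_barrier_step _ (gen k.+1)); [exact: pC | | exact: generated_coln].
by move=> a b; exact: (generated_sub (past_leq (leqnSn k)) (IH a b)).
Qed.

Lemma generated_level k : measurable_fun setT (fun t : gen k => level C0 (Om t) k).
Proof.
elim: k => [|k IH] /=; first exact: measurable_cst.
apply: measurable_funD; first exact: (generated_sub (past_leq (leqnSn k)) IH).
apply: (@measurable_bshift _ (gen k.+1)); last exact: generated_coln.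
by move=> a b; apply: (@generated_sub _ _ _ _ _ _ _ (fun t => C k t a b) (past_leq (leqnSn k)));
  exact: generated_barrier.
Qed.

(** The exponential of Markov's inequality, switched off once the trace vanishes: from then on the
    kernel estimate holds whatever the level is. *)
Definition weight k t : R :=
  alive (C k t) * expR (- (5 / 12 * \tr C0 * level C0 (Om t) k)).

Lemma generated_weight k : measurable_fun setT (weight k : gen k -> R).
Proof.
have mtr : measurable_fun setT (fun t : gen k => \tr (C k t)).
  by apply: (@measurable_mxtrace _ (gen k) _ _ (C k)); exact: generated_barrier.
apply: measurable_funM.
  by apply: measurable_funM => //; exact: (@measurable_funV _ (gen k)).
apply: measurableT_comp => //; apply: measurable_funN; apply: measurable_funM => //.
exact: generated_level.
Qed.

Lemma weight_bounds k t : 0 <= weight k t <= 1.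
Proof.
rewrite /weight aliveP mulr_ge0 ?expR_ge0 //=.
rewrite mulr_ile1 ?expR_ge0 ?lern1 ?leq_b1 // expR_le1 oppr_le0.
by rewrite !mulr_ge0 ?psd_tr_ge0 ?level_ge0.
Qed.

Let mX p : measurable_fun setT (entry Om p).
Proof. by case: gOm => h _ _; exact: h. Qed.

Lemma past_measurable k (f : T -> R) :
  measurable_fun setT (f : gen k -> R) -> measurable_fun setT f.
Proof. exact: (@generated_meas _ _ _ _ _ mX (past d s k) f). Qed.

Lemma weight_rint k : rint (weight k).
Proof.
apply: (@rint_bounded _ _ _ _ _ 1).
  exact: (@past_measurable _ _ (@generated_weight k)).
by move=> t; have /andP[w0 w1] := weight_bounds k t; rewrite ger0_norm.
Qed.

Lemma bform_sum_pairs (A : 'M[R]_d) w :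
  bform A w w = \sum_(p : 'I_d * 'I_d) A p.1 p.2 * (w p.1 0 * w p.2 0).
Proof.
rewrite -(pair_bigA _ (fun j k => A j k * (w j 0 * w k 0))) /=.
rewrite /bform mxE exchange_big; apply: eq_bigr => k _.
rewrite mxE mulr_suml; apply: eq_bigr => j _; rewrite mxE; ring.
Qed.

Lemma weight_quad (j : 'I_s) (A : T -> 'M[R]_d) :
  mxmeas (fun t : gen j => A t) -> (forall t, psd (A t) /\ \tr (A t) <= 1) ->
  rint (fun t => weight j t * bform (A t) (col j (Om t)) (col j (Om t))) /\
  \int[Pr]_t (weight j t * bform (A t) (col j (Om t)) (col j (Om t))) =
  \int[Pr]_t (weight j t * \tr (A t)).
Proof.
move=> mA pA.
pose G (p : 'I_d * 'I_d) t := weight j t * A t p.1 p.2.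
have mG p : measurable_fun setT (G p : gen j -> R).
  by apply: measurable_funM; [exact: generated_weight | exact: mA].
have iG p : rint (G p).
  apply: (@rint_bounded _ _ _ _ _ 1); first exact: (@past_measurable _ _ (mG p)).
  move=> t; have /andP[w0 w1] := weight_bounds j t; have [pAt tA] := pA t.
  rewrite normrM; apply: mulr_ile1 => //; first by rewrite ger0_norm.
  exact: le_trans (psd_entry_le _ _ pAt) tA.
have e4 (p : 'I_d * 'I_d) (a : 'I_d) : (mult2 p a <= 4)%N.
  by rewrite /mult2; case: (a == p.1); case: (a == p.2).
have [h1 h2] := column_poly gOm e4 mG iG.
have e1 : (fun t => weight j t * bform (A t) (col j (Om t)) (col j (Om t))) =
    (fun t => \sum_p G p t * \prod_a Om t a j ^+ mult2 p a).
  apply/funext => t; rewrite bform_sum_pairs mulr_sumr; apply: eq_bigr => p _.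
  by rewrite prod_expr_mult2 !mxE mulrA.
have e2 : (fun t => weight j t * \tr (A t)) =
    (fun t => \sum_p G p t * \prod_a nmom R (mult2 p a)).
  apply/funext => t; rewrite -wick2_sum mulr_sumr.
  by apply: eq_bigr => p _; rewrite mulrA.
by rewrite e1 e2.
Qed.

(** Both matrices depend only on the earlier columns, so integrating out column [j] leaves the
    fourth-order Wick sum, which is at most 3 pointwise. *)
Lemma weight_quad2 (j : 'I_s) (A B : T -> 'M[R]_d) :
  mxmeas (fun t : gen j => A t) -> (forall t, psd (A t) /\ \tr (A t) <= 1) ->
  mxmeas (fun t : gen j => B t) -> (forall t, psd (B t) /\ \tr (B t) <= 1) ->
  let f t := weight j t * (bform (A t) (col j (Om t)) (col j (Om t))
                         * bform (B t) (col j (Om t)) (col j (Om t))) in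
  rint f /\ \int[Pr]_t f t <= 3 * \int[Pr]_t weight j t.
Proof.
move=> mA pA mB pB f.
pose G (x : ('I_d * 'I_d) * ('I_d * 'I_d)) t :=
  weight j t * (A t x.1.1 x.1.2 * B t x.2.1 x.2.2).
pose e (x : ('I_d * 'I_d) * ('I_d * 'I_d)) a := (mult2 x.1 a + mult2 x.2 a)%N.
have mG x : measurable_fun setT (G x : gen j -> R).
  apply: measurable_funM; first exact: generated_weight.
  by apply: measurable_funM; [exact: mA | exact: mB].
have iG x : rint (G x).
  apply: (@rint_bounded _ _ _ _ _ 1); first exact: (@past_measurable _ _ (mG x)).
  move=> t; have /andP[w0 w1] := weight_bounds j t.
  have [pAt tA] := pA t; have [pBt tB] := pB t.
  have w1' : `|weight j t| <= 1 by rewrite ger0_norm.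
  have a1 := le_trans (psd_entry_le x.1.1 x.1.2 pAt) tA.
  have b1 := le_trans (psd_entry_le x.2.1 x.2.2 pBt) tB.
  rewrite /G normrM [X in _ * X]normrM; apply: mulr_ile1 => //.
  exact: mulr_ile1.
have e4 x a : (e x a <= 4)%N.
  by rewrite /e /mult2; case: (a == _); case: (a == _); case: (a == _); case: (a == _).
have [h1 h2] := column_poly gOm e4 mG iG.
have e1 : f = (fun t => \sum_x G x t * \prod_a Om t a j ^+ e x a).
  apply/funext => t; rewrite /f !bform_sum_pairs big_distrlr /= mulr_sumr.
  rewrite -(pair_bigA _ (fun p q => G (p, q) t * \prod_a Om t a j ^+ e (p, q) a)) /=.
  apply: eq_bigr => p _; rewrite mulr_sumr; apply: eq_bigr => q _.
  have -> : \prod_a Om t a j ^+ e (p, q) a =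
      (Om t p.1 j * Om t p.2 j) * (Om t q.1 j * Om t q.2 j).
    rewrite -!(prod_expr_mult2 (fun a => Om t a j)) -big_split /=.
    by apply: eq_bigr => a _; rewrite -exprD.
  by rewrite /G !mxE /=; ring.
rewrite e1; split => //; rewrite h2 -RintegralZl //; last exact: weight_rint.
have iw := weight_rint j.
apply: le_Rintegral => //.
- apply: rint_sum => x; under eq_fun do rewrite mulrC.
  exact: rintZ.
- exact: rintZ.
- move=> t _; have /andP[w0 _] := weight_bounds j t; rewrite [leRHS]mulrC.
  have [pAt tA] := pA t; have [pBt tB] := pB t.
  apply: le_trans (ler_wpM2l w0 (wick4_sum_le pAt pBt tA tB)).
  by rewrite mulr_sumr; apply: ler_sum => x _; rewrite /G [leRHS]mulrA.
Qed.

(** Given the past, [a] has mean 1 where the weight is nonzero, while [a b] and [a^2] have mean at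
    most 3. The factor is [1 - 1/6 + 3/48 + 3/144 = 11/12]. *)
Lemma weight_decay (j : 'I_s) :
  \int[Pr]_t weight j.+1 t <= 11 / 12 * \int[Pr]_t weight j t.
Proof.
pose A t := sqr_normalized (C j t); pose B t := normalized (C j t).
have pA t : psd (A t) /\ \tr (A t) <= 1 by exact: sqr_normalized_psd.
have pB t : psd (B t) /\ \tr (B t) <= 1 by exact: normalized_psd.
have mC := @generated_barrier j.
have mCC : mxmeas (fun t : gen j => C j t *m C j t) by exact: mxmeasM.
have mA : mxmeas (fun t : gen j => A t).
  by apply: mxmeasZ => //; apply: measurable_funV; exact: measurable_mxtrace.
have mB : mxmeas (fun t : gen j => B t).
  by apply: mxmeasZ => //; apply: measurable_funV; exact: measurable_mxtrace.
pose a t := bform (A t) (col j (Om t)) (col j (Om t)).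
pose b t := bform (B t) (col j (Om t)) (col j (Om t)).
have [i1 e1] := weight_quad mA pA.
have [i2 e2] := weight_quad2 mA pA mB pB.
have [i3 e3] := weight_quad2 mA pA mA pA.
rewrite -/(a _) in i1 e1.
have i0 := weight_rint j.
pose f t := weight j t + (-1 / 6) * (weight j t * a t)
  + 1 / 48 * (weight j t * (a t * b t)) + 1 / 144 * (weight j t * (a t * a t)).
have i01 : rint (fun t => weight j t + (-1 / 6) * (weight j t * a t)).
  by apply: rintD => //; exact: rintZ.
have i02 : rint (fun t => weight j t + (-1 / 6) * (weight j t * a t)
    + 1 / 48 * (weight j t * (a t * b t))).
  by apply: rintD => //; exact: rintZ.
have if_ : rint f by apply: rintD => //; exact: rintZ.
apply: (@le_trans _ _ (\int[Pr]_t f t)).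
  apply: le_Rintegral => //; first exact: weight_rint.
  move=> t _; have cj : coln (Om t) j = col j (Om t) by rewrite /coln valK.
  have := step_weight_le (col j (Om t)) (pC j t) (barrier_tr (Om t) j pC0).
  have -> : f t = alive (C j t) * step_poly (C j t) (col j (Om t)) *
      expR (- (5 / 12 * \tr C0 * level C0 (Om t) j)).
    by rewrite /f /weight /step_poly -/(A t) -/(B t) -/(a t) -/(b t); ring.
  have -> : weight j.+1 t = alive (barrier_step (C j t) (col j (Om t)))
      * expR (- (5 / 12 * \tr C0 * bshift (C j t) (col j (Om t))))
      * expR (- (5 / 12 * \tr C0 * level C0 (Om t) j)).
    by rewrite /weight /C /= cj mulrDr opprD addrC expRD mulrA.
  by rewrite ler_pM2r ?expR_gt0.
have -> : \int[Pr]_t f t = \int[Pr]_t weight j t + (-1 / 6) * \int[Pr]_t (weight j t * a t)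
   + 1 / 48 * \int[Pr]_t (weight j t * (a t * b t))
   + 1 / 144 * \int[Pr]_t (weight j t * (a t * a t)).
  rewrite (RintegralD measurableT i02 (rintZ _ i3)).
  rewrite (RintegralD measurableT i01 (rintZ _ i2)).
  rewrite (RintegralD measurableT i0 (rintZ _ i1)).
  by rewrite !RintegralZl.
have -> : \int[Pr]_t (weight j t * a t) = \int[Pr]_t weight j t.
  rewrite e1; apply: eq_Rintegral => t _.
  by rewrite /weight mulrAC /A alive_sqr_normalized.
rewrite -/(a _) -/(b _) in e2 e3; lra.
Qed.

Lemma weight_total : \int[Pr]_t weight s t <= (11 / 12) ^+ s.
Proof.
suff h k : (k <= s)%N -> \int[Pr]_t weight k t <= (11 / 12) ^+ k by exact: h.
elim: k => [_|k IH ks].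
  rewrite expr0 -[leRHS](Rintegral_cst1 Pr); apply: le_Rintegral => //.
  - exact: weight_rint.
  - exact: rint_cst.
  - by move=> t _; have /andP[] := weight_bounds 0 t.
rewrite exprS (le_trans (weight_decay (Ordinal ks))) //=.
by rewrite ler_wpM2l // IH // ltnW.
Qed.

(** Markov's inequality bounds the complement of [A]. On [A], either the weight is switched off or
    its exponential is so small that the level exceeds [c]. *)
Lemma barrier_success (c : R) :
  let A := [set t | weight s t < expR (- (5 / 12 * \tr C0 * c))] in
  [/\ measurable A,
      forall t, A t -> \tr (barrier C0 (Om t) s) = 0 \/ c <= level C0 (Om t) s &
      ((1 - expR (5 / 12 * \tr C0 * c) * (11 / 12) ^+ s)%:E <= Pr A)%E].
Proof.
set T0 := 5 / 12 * \tr C0; move=> A.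
have mW : measurable_fun setT (weight s) := @past_measurable _ _ (@generated_weight s).
have mA : measurable A.
  have -> : A = setT `&` (weight s @^-1` `]-oo, expR (- (T0 * c))[%classic).
    by rewrite setTI; apply/seteqP; split => t /=; rewrite in_itv.
  exact: mW.
have T0_ge0 : 0 <= T0 by rewrite /T0 mulr_ge0 ?psd_tr_ge0.
split => //.
  move=> t; rewrite /A /= /weight aliveP -/T0.
  have [->|t0] := eqVneq (\tr (C s t)) 0; first by left.
  rewrite mul1r ltr_expR ltrN2 => h; right; rewrite leNgt; apply/negP => lc.
  by have := ler_wpM2l T0_ge0 (ltW lc); rewrite leNgt h.
have mcA : measurable (~` A) by exact: measurableC.
have ic : rint (fun t => expR (- (T0 * c)) * \1_(~` A) t).
  by apply: rintZ; exact: integrable_indic.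
have : expR (- (T0 * c)) * fine (Pr (~` A)) <= (11 / 12) ^+ s.
  apply: le_trans weight_total.
  have -> : expR (- (T0 * c)) * fine (Pr (~` A)) =
      \int[Pr]_t (expR (- (T0 * c)) * \1_(~` A) t).
    rewrite RintegralZl //; last exact: integrable_indic.
    by congr (_ * _); rewrite /Rintegral integral_indic // setIT.
  apply: le_Rintegral => //; first exact: weight_rint.
  move=> t _; rewrite indicE; case: (boolP (t \in ~` A)) => [|_] /=.
    rewrite mulr1 inE /A /= => /negP; by rewrite -leNgt.
  by rewrite mulr0; have /andP[] := weight_bounds s t.
rewrite expRN mulrC ler_pdivrMr ?expR_gt0 // => h.
have fA : Pr A \is a fin_num by rewrite fin_num_measure.
rewrite -(fineK fA) lee_fin lerBlDr.
have := probability_setC Pr mA; rewrite -{1}(fineK fA) => e.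
have : fine (Pr (~` A)) = 1 - fine (Pr A) by rewrite e.
by move: h => /[swap] ->; lra.
Qed.

End FailureProbability.

(** * Numerical estimates and conclusion *)

Lemma sketch_size_bounds (R : realType) (k L : R) (s : nat) : 0 <= k -> 0 <= L ->
  8 * (Num.sqrt k + Num.sqrt (8 * L)) ^+ 2 <= s%:R ->
  8 * k <= s%:R /\ 64 * L <= s%:R.
Proof.
move=> k0 L0 h; have L8 : 0 <= 8 * L by rewrite mulr_ge0.
have := mulr_ge0 (sqrtr_ge0 k) (sqrtr_ge0 (8 * L)).
have := sqr_sqrtr k0; have := sqr_sqrtr L8; move: h.
move: (Num.sqrt k) (Num.sqrt _) => a b h e1 e2 ab.
by split; lra.
Qed.

(** From [(11/12)^s <= exp (- s / 12)] and [k <= s / 8], the exponent is at most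
    [(275/4608 - 1/12) s = - 109/4608 s]. This is below [- s / 64], hence below [- ln (16 / delta)],
    so the bound is even [delta / 16]. *)
Lemma failure_bound (R : realType) (k delta : R) (s : nat) : 0 < delta ->
  8 * k <= s%:R -> 64 * ln (16 / delta) <= s%:R ->
  expR (5 / 12 * k * (55 / 48)) * (11 / 12) ^+ s <= delta.
Proof.
move=> d0 ks Ls.
have p : (11 / 12) ^+ s <= expR (- (s%:R / 12)) :> R.
  have -> : - (s%:R / 12) = s%:R * (- 1 / 12) :> R by field.
  rewrite expRM_natl lerXn2r ?nnegrE ?expR_ge0 //.
  by apply: le_trans (expR_ge1Dx _); lra.
apply: (@le_trans _ _ (expR (- ln (16 / delta)))).
  rewrite (le_trans (ler_wpM2l (expR_ge0 _) p)) // -expRD ler_expR.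
  by have := ler0n R s; lra.
rewrite expRN lnK ?posrE ?divr_gt0 // invf_div.
by lra.
Qed.

Theorem theorem4p1 (R : realType) (d0 : measure_display) (T : measurableType d0)
  (Pr : probability T R) (d s : nat) (H : 'M[R]_d) (rho delta : R)
  (Om : T -> 'M[R]_(d, s)) :
  psd H -> 0 < rho -> 0 < delta < 1 ->
  iid_std_gaussian Pr Om ->
  8 * (Num.sqrt (eff_dim H rho) + Num.sqrt (8 * ln (16 / delta))) ^+ 2
    <= s%:R ->
  exists A : set T, [/\ measurable A,
    A `<=` [set t | forall (U : 'M[R]_(d, s)) (lam : 'rV[R]_s),
              nystrom_eig (nystrom H (Om t)) U lam ->
              let S := inv_sqrt (nystrom_precond U lam rho) in
              kappa2 (S *m (H + rho%:M) *m S) <= 8]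
    & ((1 - delta)%:E <= Pr A)%E].
Proof.
move=> pH rho0 /andP[dl0 dl1] gOm size_s.
have L0 : 0 < ln (16 / delta).
  by rewrite ln_gt0 // ltr_pdivlMr // mul1r (lt_trans dl1) // ltr1n.
have [ks Ls] := sketch_size_bounds (eff_dim_ge0 pH rho0) (ltW L0) size_s.
have [mA goodA PA] := barrier_success gOm (smoothing_psd pH rho0) (55 / 48).
eexists; split; first exact: mA; last first.
  apply: le_trans PA; rewrite lee_fin lerD2l lerN2.
  exact: failure_bound.
move=> t At U lam eigN.
(* An empty sketch is excluded by [0 < 64 ln (16 / delta) <= s]. *)
case: s => [|s] in Om gOm size_s ks Ls mA goodA PA At U lam eigN *.
  by move: Ls; rewrite leNgt mulr_gt0.
have e0 : 0 <= 48 / 7 * rho by rewrite mulr_ge0 // ltW.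
have EH := nystrom_residual pH e0 (fun w => smoothing_kernel_bound pH rho0 (goodA t At)).
(* From [s l <= (l + rho) k] and [8 k <= s] follows [8 l <= l + rho]. *)
have l7 : last_entry lam <= rho / 7.
  have [UU mono lam0 EN] := eigN; set l := last_entry lam.
  have l0 : 0 <= l by exact: lam0.
  have lU v : l * bform (U *m U^T) v v <= bform H v v.
    by have /andP[h _] := EH v; exact: le_trans (eig_last_le v eigN) h.
  have := precond_last_le pH rho0 l0 UU lU.
  have lr : 0 <= l + rho by rewrite addr_ge0 // ltW.
  have := ler_wpM2l lr ks.
  have s0 : 0 < s.+1%:R :> R by rewrite ltr0n.
  move: (eff_dim H rho) (s.+1%:R) s0 => k n n0 h1 h2.
  by rewrite -(ler_pM2l n0); lra.
(* The two bounds [rho / 7] and [48 rho / 7] add up to exactly [7 rho]. *)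
have le7 : last_entry lam + 48 / 7 * rho <= 7 * rho by lra.
have [uP sandwich] := precond_sandwich rho0 eigN EH e0 le7.
lazy zeta; apply: kappa2_precond_le rho0 uP _ sandwich.
(* [xget] returns either a square root of the inverse or its default 0. *)
rewrite /inv_sqrt /psd_sqrt; case: xgetP => [X _ [pX XX]|_]; last by left.
by right.
Qed.
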